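(* Let $p,q$ be primes, let $T_h$ and $T_v$ be the Bruhat–Tits trees of $\mathrm{PGL}_2(\mathbb{Q}_p)$ and $\mathrm{PGL}_2(\mathbb{Q}_q)$ respectively (regular trees of valency $p+1$ and $q+1$), and let $\Gamma<\mathrm{PGL}_2(\mathbb{Q}_p)\times \mathrm{PGL}_2(\mathbb{Q}_q)$ be a torsion free irreducible arithmetic lattice acting transitively on the vertices of the building $T_h\times T_v$. Let $\Sigma=\Gamma\backslash(T_h\times T_v)$ be the quotient square complex (a VH-T-complex with one vertex). Then the group $G(A^{T}(\Sigma))$ is a free group.
   Context: **Automata.** A finite synchronous automaton $A=\langle X,Q,\pi,\lambda\rangle$ consists of finite sets $X$ (alphabet) and $Q$ (states), a transition function $\pi:X\times Q\to Q$ and an output function $\lambda:X\times Q\to X$ (also written $\pi(q,x),\lambda(q,x)$). For $q\in Q$ the map $\mathfrak{T}(A,q):X^*\to X^*$ on the free monoid $X^*$ is defined by $\mathfrak{T}(A,q)(\emptyset)=\emptyset$ and $\mathfrak{T}(A,q)(xw)=\lambda(x,q)\,\mathfrak{T}(A,\pi(x,q))(w)$. If all these maps are bijective, $G(A)$ is the group of bijections of $X^*$ generated by $\{\mathfrak{T}(A,q)\}_{q\in Q}$. **Square complexes.** A square complex is built from a graph (with directed edges $e$, inverse edges $\overline{e}\neq e$) by attaching squares along closed paths of length four; each geometric square carries eight distinct directed squares permuted freely by the dihedral group of order 8. It is a VH-complex if its edges are partitioned into vertical and horizontal ones so that every vertex link is a bipartite graph with bipartition (horizontal, vertical). It is a VH-T-complex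 if moreover every vertex link is a complete bipartite graph. **The automaton $A^{T}(\Sigma)$.** Let $\Sigma$ be a finite VH-T-complex with one vertex. $A^{T}(\Sigma)=\langle X,Q,\pi,\lambda\rangle$ has $X$ = the set of directed horizontal edges, $Q$ = the set of directed vertical edges; for $x\in X,q\in Q$ there is a unique square incident to $x$ and $q$ near their origins, and in this square $\lambda(q,x)$ is the (directed) edge opposite to $x$ and $\pi(q,x)$ the (directed) edge opposite to $q$, directed parallel to $x$ and $q$ respectively. In $\Gamma\backslash(T_h\times T_v)$, edges coming from $T_h$ are horizontal and edges coming from $T_v$ are vertical. *)

(* Defs.v *)
From HB Require Import structures.
From mathcomp Require Import all_boot all_order all_algebra all_field.
From mathcomp Require Import generic_quotient.
From mathcomp Require Import all_classical all_reals all_analysis.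

Set Implicit Arguments.
Unset Strict Implicit.
Unset Printing Implicit Defensive.

Import Order.TTheory GRing.Theory Num.Theory.

Local Open Scope classical_set_scope.
Local Open Scope quotient_scope.
Local Open Scope ring_scope.

Section Groups.
Context (G : groupType).
Local Open Scope group_scope.

Definition subgroup (H : set G) : Prop :=
  H 1 /\ forall x y, H x -> H y -> H (x / y).

Definition generated (S : set G) : set G := smallest subgroup S.

Definition torsion_free_subgroup (H : set G) : Prop :=
  forall x n, H x -> (0 < n)%N -> x ^+ n = 1 -> x = 1.

Definition finite_index (H K : set G) : Prop :=
  exists s : seq G, K `<=` [set x * h | x in [set` s] & h in H].

Definition commensurable (H K : set G) : Prop :=
  finite_index (H `&` K) H /\ finite_index (H `&` K) K.

(* A letter (x, true) stands for x and (x, false) for x^-1. *)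
Definition word_val (w : seq (G * bool)) : G :=
  foldr (fun a g => (if a.2 then a.1 else a.1^-1) * g) 1 w.

Definition reduced_word (B : set G) (w : seq (G * bool)) : Prop :=
  (forall a, a \in w -> B a.1) /\
  sorted (fun a b => ~~ ((a.1 == b.1) && (a.2 != b.2))) w.

(* The evaluation map from the free group on B, seen as the set of reduced
   words, is a bijection onto H. *)
Definition free_basis (B H : set G) : Prop :=
  (forall w, reduced_word B w -> H (word_val w)) /\
  (forall h, H h -> exists! w, reduced_word B w /\ word_val w = h).

Definition free_subgroup (H : set G) : Prop := exists B, free_basis B H.

End Groups.

Record bijection (T : Type) := Bijection {
  bij_fun : T -> T;
  bij_inv : T -> T;
  bij_funK : cancel bij_fun bij_inv;
  bij_invK : cancel bij_inv bij_fun }.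

Section BijectionGroup.
Context (T : Type).
Implicit Types f g h : bijection T.

Lemma bijection_eq f g : bij_fun f =1 bij_fun g -> f = g.
Proof.
case: f g => [f f' fK f'K] [g g' gK g'K] /= /funext fg; subst g.
have e : f' = g' by apply/funext => x; rewrite -{1}(g'K x) fK.
by subst g'; congr Bijection; exact: Prop_irrelevance.
Qed.

HB.instance Definition _ := gen_eqMixin (bijection T).
HB.instance Definition _ := gen_choiceMixin (bijection T).

Definition bij_one := @Bijection T id id (fun=> erefl) (fun=> erefl).
Definition bij_comp f g := Bijection
  (can_comp (bij_funK f) (bij_funK g)) (can_comp (bij_invK g) (bij_invK f)).
Definition bij_symm f := Bijection (bij_invK f) (bij_funK f).

Lemma bij_compA : associative bij_comp.
Proof. by move=> f g h; exact: bijection_eq. Qed.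
Lemma bij_comp1l : left_id bij_one bij_comp.
Proof. by move=> f; exact: bijection_eq. Qed.
Lemma bij_comp1r : right_id bij_one bij_comp.
Proof. by move=> f; exact: bijection_eq. Qed.
Lemma bij_symml : left_inverse bij_one bij_symm bij_comp.
Proof. by move=> f; apply: bijection_eq => x /=; rewrite bij_funK. Qed.
Lemma bij_symmr : right_inverse bij_one bij_symm bij_comp.
Proof. by move=> f; apply: bijection_eq => x /=; rewrite bij_invK. Qed.

HB.instance Definition _ := isGroup.Build (bijection T)
  bij_compA bij_comp1l bij_comp1r bij_symml bij_symmr.

End BijectionGroup.

Record automaton := Automaton {
  alphabet : Type;
  state : Type;
  trans : alphabet -> state -> state;
  out : alphabet -> state -> alphabet }.

Fixpoint automaton_map (A : automaton) (q : state A) (w : seq (alphabet A)) :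
    seq (alphabet A) :=
  if w is x :: w' then out x q :: automaton_map (trans x q) w' else [::].

Definition invertible (A : automaton) : Prop :=
  forall q : state A, bijective (automaton_map q).

Definition automaton_group (A : automaton) : set (bijection (seq (alphabet A))) :=
  generated [set b | exists q : state A, bij_fun b =1 automaton_map q].
Arguments automaton_group : clear implicits.

(* [square] is the type of directed squares.  A directed square s has the closed
   path side s, side (rot s), side (rot^2 s), side (rot^3 s) as boundary; rot
   moves the base point one step along it, and flip keeps the base point and
   reverses the path.  The eight directed squares of a geometric square are the
   orbit of one of them under rot and flip. *)
Record complex := Complex {
  vert : Type;
  edge : Type;
  square : Type;
  src : edge -> vert;
  einv : edge -> edge;
  side : square -> edge;
  rot : square -> square;
  flip : square -> square;
  horizontal : edge -> Prop }.

Definition tgt (C : complex) (e : edge C) : vert C := src (einv e).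

Definition is_square_complex (C : complex) : Prop :=
  [/\ forall e : edge C, einv (einv e) = e /\ einv e <> e,
      forall s : square C, [/\ iter 4 (@rot C) s = s, flip (flip s) = s
                             & rot (flip (rot s)) = flip s],
      forall s : square C, tgt (side s) = src (side (rot s)) /\
                           side (flip s) = einv (side (iter 3 (@rot C) s))
    & forall (s : square C) k, (k < 4)%N ->
        (iter k (@rot C) s = s -> k = 0%N) /\ iter k (@rot C) (flip s) <> s].

(* In the link of a vertex, whose vertices are the directed edges issued from it,
   the link edge given by the corner of s joins side s and side (flip s). *)
Definition is_VH_complex (C : complex) : Prop :=
  [/\ is_square_complex C,
      forall e : edge C, horizontal (einv e) <-> horizontal e
    & forall s : square C, horizontal (side s) <-> ~ horizontal (side (flip s))].

Definition is_VHT_complex (C : complex) : Prop :=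
  is_VH_complex C /\
  forall x q : edge C, src x = src q -> horizontal x -> ~ horizontal q ->
    exists! s : square C, side s = x /\ side (flip s) = q.

Definition one_vertex (C : complex) : Prop :=
  exists v : vert C, forall w, w = v.

Definition finite_complex (C : complex) : Prop :=
  [/\ finite_set [set: vert C], finite_set [set: edge C]
    & finite_set [set: square C]].

Definition choose_or (T : Type) (x0 : T) (P : set T) : T :=
  if pselect (exists x, P x) is left Px then projT1 (cid Px) else x0.

Section AT.
Context (C : complex).

Definition hedge : Type := {e : edge C | horizontal e}.
Definition vedge : Type := {e : edge C | ~ horizontal e}.

(* s is incident to x and q near their origins *)
Definition at_corner (x : hedge) (q : vedge) (s : square C) : Prop :=
  side s = proj1_sig x /\ side (flip s) = proj1_sig q.

(* The last argument of [choose_or] pins down a unique edge as soon as C is a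
   VH-T-complex with one vertex; the default value is then irrelevant. *)
Definition AT : automaton := {|
  alphabet := hedge;
  state := vedge;
  trans := fun x q => choose_or q [set q' | exists s, at_corner x q s /\
             proj1_sig q' = side (rot s)];
  out := fun x q => choose_or x [set x' | exists s, at_corner x q s /\
             proj1_sig x' = einv (side (rot (rot s)))] |}.

End AT.

Record graph := Graph {
  gvert : Type;
  gedge : Type;
  gsrc : gedge -> gvert;
  ginv : gedge -> gedge }.

(* (e, f, true) is the directed square e x f whose boundary starts with e, and
   (e, f, false) the one, with the same base point, whose boundary starts
   with f. *)
Definition product_complex (Th Tv : graph) : complex := {|
  vert := gvert Th * gvert Tv;
  edge := gedge Th * gvert Tv + gvert Th * gedge Tv;
  square := gedge Th * gedge Tv * bool;
  src := fun e => match e with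
                  | inl (a, v) => (gsrc a, v)
                  | inr (u, b) => (u, gsrc b)
                  end;
  einv := fun e => match e with
                   | inl (a, v) => inl (ginv a, v)
                   | inr (u, b) => inr (u, ginv b)
                   end;
  side := fun s => let: (e, f, h) := s in
            if h then inl (e, gsrc f) else inr (gsrc e, f);
  rot := fun s => let: (e, f, h) := s in
            if h then (ginv e, f, false) else (e, ginv f, true);
  flip := fun s => let: (e, f, h) := s in (e, f, ~~ h);
  horizontal := fun e => if e is inl _ then True else False |}.

Section Orbits.
Context (G T : Type) (act : G -> T -> T) (H : set G).

Definition orbit (x : T) : set T := [set act g x | g in H].
Definition orbits : Type := {O : set T | exists x, O = orbit x}.
Definition orbit_of (x : T) : orbits :=
  exist (fun O => exists x, O = orbit x) (orbit x) (ex_intro _ x erefl).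
Definition orbit_rep (O : orbits) : T := projT1 (cid (proj2_sig O)).

End Orbits.

(* The choice of representatives is immaterial when G acts by automorphisms. *)
Definition quotient_complex (C : complex) (G : Type) (H : set G)
    (actv : G -> vert C -> vert C) (acte : G -> edge C -> edge C)
    (acts : G -> square C -> square C) : complex := {|
  vert := orbits actv H;
  edge := orbits acte H;
  square := orbits acts H;
  src := fun e => orbit_of actv H (src (orbit_rep e));
  einv := fun e => orbit_of acte H (einv (orbit_rep e));
  side := fun s => orbit_of acte H (side (orbit_rep s));
  rot := fun s => orbit_of acts H (rot (orbit_rep s));
  flip := fun s => orbit_of acts H (flip (orbit_rep s));
  horizontal := fun e => horizontal (orbit_rep e) |}.

(* A completion of the field of rational numbers for the p-adic absolute value,
   i.e. a model of Q_p; it is unique up to unique isometric isomorphism. *)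
Record padicField (p : nat) := PadicField {
  padic :> fieldType;
  pnorm : padic -> rat;
  padic_prime : prime p;
  pnorm_ge0 : forall x, 0 <= pnorm x;
  pnorm_eq0 : forall x, (pnorm x == 0) = (x == 0);
  pnormM : forall x y, pnorm (x * y) = pnorm x * pnorm y;
  pnormD : forall x y, pnorm (x + y) <= Num.max (pnorm x) (pnorm y);
  pnorm_nat : forall n, (0 < n)%N -> pnorm n%:R = p%:R ^- logn p n;
  pnorm_dense : forall x e, 0 < e -> exists r : rat, pnorm (x - ratr r) < e;
  pnorm_complete : forall u : nat -> padic,
    (forall e, 0 < e -> exists N, forall m n, (N <= m)%N -> (N <= n)%N ->
       pnorm (u m - u n) < e) ->
    exists l, forall e, 0 < e -> exists N, forall n, (N <= n)%N ->
       pnorm (u n - l) < e }.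

Lemma padic_p_neq0 p (K : padicField p) : p%:R != 0 :> K.
Proof.
have p_pr := padic_prime K.
rewrite -pnorm_eq0 pnorm_nat ?prime_gt0 // invr_eq0 expf_neq0 //.
by rewrite pnatr_eq0 -lt0n prime_gt0.
Qed.

Section PGL2.
Context (p : nat) (K : padicField p).

Definition GL2 : Type := {A : 'M[K]_2 | A \in unitmx}.
HB.instance Definition _ := Choice.on GL2.

Definition proportional (A B : GL2) : bool :=
  `[< exists c : K, c != 0 /\ val A = c *: val B >].

Lemma proportional_refl : reflexive proportional.
Proof. by move=> A; apply/asboolP; exists 1; rewrite oner_neq0 scale1r. Qed.

Lemma proportional_sym : symmetric proportional.
Proof.
suff h A B : proportional A B -> proportional B A.
  by move=> A B; apply/idP/idP; exact: h.
move=> /asboolP[c [c0 AB]]; apply/asboolP; exists c^-1.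
by rewrite invr_eq0 AB scalerA mulVf // scale1r.
Qed.

Lemma proportional_trans : transitive proportional.
Proof.
move=> B A C /asboolP[c [c0 AB]] /asboolP[d [d0 BC]]; apply/asboolP.
by exists (c * d); rewrite mulf_neq0 // AB BC scalerA.
Qed.

Canonical proportional_equiv :=
  EquivRel proportional proportional_refl proportional_sym proportional_trans.

Definition PGL2 : Type := {eq_quot proportional}.
HB.instance Definition _ := Choice.on PGL2.
HB.instance Definition _ := EqQuotient.on PGL2.

Definition gl_one : GL2 := Sub (1%:M : 'M[K]_2) (unitmx1 _ _).

Lemma gl_mul_subproof (A B : GL2) : val A *m val B \in unitmx.
Proof. by rewrite unitmx_mul (valP A) (valP B). Qed.
Definition gl_mul (A B : GL2) : GL2 :=
  Sub (val A *m val B) (gl_mul_subproof A B).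

Lemma gl_inv_subproof (A : GL2) : invmx (val A) \in unitmx.
Proof. by rewrite unitmx_inv (valP A). Qed.
Definition gl_inv (A : GL2) : GL2 := Sub (invmx (val A)) (gl_inv_subproof A).

Definition pgl_of (A : GL2) : PGL2 := \pi_PGL2 A.
Definition pgl_rep (g : PGL2) : GL2 := repr g.

Lemma pgl_repK g : pgl_of (pgl_rep g) = g.
Proof. exact: reprK. Qed.

Lemma pgl_ofP (A B : GL2) :
  pgl_of A = pgl_of B <-> exists c : K, c != 0 /\ val A = c *: val B.
Proof.
split; first by move=> /eqmodP/asboolP.
by move=> h; apply/eqmodP/asboolP.
Qed.

Lemma pgl_of_repP (A : GL2) :
  exists c : K, c != 0 /\ val (pgl_rep (pgl_of A)) = c *: val A.
Proof. by apply/pgl_ofP; rewrite pgl_repK. Qed.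

Definition pgl_one : PGL2 := pgl_of gl_one.
Definition pgl_mul (g h : PGL2) : PGL2 :=
  pgl_of (gl_mul (pgl_rep g) (pgl_rep h)).
Definition pgl_inv (g : PGL2) : PGL2 := pgl_of (gl_inv (pgl_rep g)).

Lemma pgl_ofM A B : pgl_mul (pgl_of A) (pgl_of B) = pgl_of (gl_mul A B).
Proof.
apply/pgl_ofP => /=.
have [c [c0 ->]] := pgl_of_repP A; have [d [d0 ->]] := pgl_of_repP B.
by exists (c * d); rewrite mulf_neq0 // -scalemxAl -scalemxAr scalerA.
Qed.

Lemma pgl_mulA : associative pgl_mul.
Proof.
move=> f g h; rewrite -(pgl_repK f) -(pgl_repK g) -(pgl_repK h) !pgl_ofM.
by congr pgl_of; apply: val_inj; rewrite /= mulmxA.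
Qed.

Lemma pgl_mul1l : left_id pgl_one pgl_mul.
Proof.
move=> g; rewrite -(pgl_repK g) pgl_ofM.
by congr pgl_of; apply: val_inj; rewrite /= mul1mx.
Qed.

Lemma pgl_mul1r : right_id pgl_one pgl_mul.
Proof.
move=> g; rewrite -(pgl_repK g) pgl_ofM.
by congr pgl_of; apply: val_inj; rewrite /= mulmx1.
Qed.

Lemma pgl_mulV : left_inverse pgl_one pgl_inv pgl_mul.
Proof.
move=> g; rewrite -{2}(pgl_repK g) pgl_ofM.
by congr pgl_of; apply: val_inj; rewrite /= mulVmx // (valP (pgl_rep g)).
Qed.

Lemma pgl_mulVr : right_inverse pgl_one pgl_inv pgl_mul.
Proof.
move=> g; rewrite -{1}(pgl_repK g) pgl_ofM.
by congr pgl_of; apply: val_inj; rewrite /= mulmxV // (valP (pgl_rep g)).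
Qed.

HB.instance Definition _ :=
  isGroup.Build PGL2 pgl_mulA pgl_mul1l pgl_mul1r pgl_mulV pgl_mulVr.
HB.instance Definition _ := isPointed.Build PGL2 pgl_one.

(* The quotient topology of the topology of GL_2(K) as a subspace of M_2(K). *)
Definition pgl_open (U : set PGL2) : Prop :=
  forall A : GL2, U (pgl_of A) -> exists2 e : rat, 0 < e &
    forall B : GL2, (forall i j, pnorm (val B i j - val A i j) < e) ->
      U (pgl_of B).

Lemma pgl_openT : pgl_open setT.
Proof. by move=> A _; exists 1. Qed.

Lemma pgl_openI : setI_closed pgl_open.
Proof.
move=> U V oU oV A [/oU[d d0 dU] /oV[e e0 eV]].
exists (Num.min d e); first by rewrite lt_min d0.
move=> B AB; split; [apply: dU|apply: eV] => i j;
  by have := AB i j; rewrite lt_min => /andP[].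
Qed.

Lemma pgl_open_bigU (I : Type) (f : I -> set PGL2) :
  (forall i, pgl_open (f i)) -> pgl_open (\bigcup_i f i).
Proof.
move=> of_ A [i _ /of_[e e0 eU]]; exists e => // B /eU fB.
by exists i.
Qed.

HB.instance Definition _ :=
  isOpenTopological.Build PGL2 pgl_openT pgl_openI pgl_open_bigU.

(* The Z_p-lattice in K^2 spanned by the columns of A *)
Definition lattice_of (A : 'M[K]_2) : set 'cV[K]_2 :=
  [set A *m x | x in [set x : 'cV[K]_2 | forall i j, pnorm (x i j) <= 1]].

Definition homothety_class (A : 'M[K]_2) : set (set 'cV[K]_2) :=
  [set lattice_of (c *: A) | c in [set c : K | c != 0]].

Definition bt_vertex : Type :=
  {V : set (set 'cV[K]_2) | exists A, A \in unitmx /\ V = homothety_class A}.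

Definition adjacent (U V : bt_vertex) : Prop :=
  exists L M, [/\ proj1_sig U L, proj1_sig V M, M `<` L
                & [set p%:R *: x | x in L] `<` M].

Definition bt_edge : Type := {e : bt_vertex * bt_vertex | adjacent e.1 e.2}.

Lemma scale_lattice_of (c : K) A :
  [set c *: x | x in lattice_of A] = lattice_of (c *: A).
Proof.
rewrite /lattice_of image_comp; apply: eq_imagel => x _ /=.
by rewrite scalemxAl.
Qed.

Lemma mul_lattice_of B A :
  [set B *m x | x in lattice_of A] = lattice_of (B *m A).
Proof.
rewrite /lattice_of image_comp; apply: eq_imagel => x _ /=.
by rewrite mulmxA.
Qed.

Lemma proper_image (T T' : Type) (f : T -> T') (A B : set T) :
  injective f -> A `<` B -> f @` A `<` f @` B.
Proof.
move=> fI [AB nBA]; split; first exact: image_subset.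
move=> h; apply: nBA => x Bx; have [|y Ay /fI <-] := h (f x); last by [].
by exists x.
Qed.

Lemma adjacent_sym U V : adjacent U V -> adjacent V U.
Proof.
move=> [L [M [UL VM ML LM]]]; exists M, [set p%:R *: x | x in L].
split=> //; last first.
  apply: proper_image ML => x y /(congr1 ( *:%R (p%:R)^-1)).
  by rewrite !scalerA mulVf ?padic_p_neq0 // !scale1r.
case: U UL => U [A [Au UA]] /=; rewrite UA => -[c c0 <-].
exists (p%:R * c); first by rewrite /= mulf_neq0 ?padic_p_neq0.
by rewrite scale_lattice_of scalerA.
Qed.

Definition bt_einv (e : bt_edge) : bt_edge :=
  exist (fun e => adjacent e.1 e.2) ((proj1_sig e).2, (proj1_sig e).1)
        (adjacent_sym (proj2_sig e)).

Definition bt_tree : graph :=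
  Graph (fun e : bt_edge => (proj1_sig e).1) bt_einv.

Lemma bt_act_subproof (g : PGL2) (V : bt_vertex) :
  exists A, A \in unitmx /\
    [set [set val (pgl_rep g) *m x | x in L] | L in proj1_sig V]
    = homothety_class A.
Proof.
have [A [Au VA]] := proj2_sig V; exists (val (pgl_rep g) *m A); rewrite VA.
rewrite unitmx_mul Au (valP (pgl_rep g)); split=> //.
rewrite /homothety_class image_comp; apply: eq_imagel => c _ /=.
by rewrite mul_lattice_of scalemxAr.
Qed.

(* This does not depend on the choice of the representative of g. *)
Definition bt_act (g : PGL2) (V : bt_vertex) : bt_vertex :=
  exist (fun V => exists A, A \in unitmx /\ V = homothety_class A)
        _ (bt_act_subproof g V).

Lemma bt_act_adjacent g U V :
  adjacent U V -> adjacent (bt_act g U) (bt_act g V).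
Proof.
move=> [L [M [UL VM ML LM]]].
set B := val (pgl_rep g).
have BI : injective (fun x : 'cV[K]_2 => B *m x).
  by apply: can_inj (mulmx (invmx B)) _ => x; rewrite mulKmx ?(valP (pgl_rep g)).
exists [set B *m x | x in L], [set B *m x | x in M]; split.
- by exists L.
- by exists M.
- exact: proper_image.
- have -> : [set p%:R *: x | x in [set B *m x | x in L]] =
            [set B *m x | x in [set p%:R *: x | x in L]].
    by rewrite !image_comp; apply: eq_imagel => x _ /=; rewrite scalemxAr.
  exact: proper_image.
Qed.

Definition bt_acte (g : PGL2) (e : bt_edge) : bt_edge :=
  exist (fun e => adjacent e.1 e.2)
        (bt_act g (proj1_sig e).1, bt_act g (proj1_sig e).2)
        (bt_act_adjacent g (proj2_sig e)).

End PGL2.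

Section Lattices.
Context (p q : nat) (Kp : padicField p) (Kq : padicField q).

Local Notation PGLxPGL := (PGL2 Kp * PGL2 Kq)%type.

Implicit Type Gamma : set PGLxPGL.

Definition building : complex := product_complex (bt_tree Kp) (bt_tree Kq).

Definition act_vert (g : PGLxPGL) (v : vert building) : vert building :=
  (bt_act g.1 v.1, bt_act g.2 v.2).

Definition act_edge (g : PGLxPGL) (e : edge building) : edge building :=
  match e with
  | inl (a, v) => inl (bt_acte g.1 a, bt_act g.2 v)
  | inr (u, b) => inr (bt_act g.1 u, bt_acte g.2 b)
  end.

Definition act_square (g : PGLxPGL) (s : square building) : square building :=
  let: (e, f, h) := s in (bt_acte g.1 e, bt_acte g.2 f, h).

Definition building_quotient Gamma : complex :=
  quotient_complex Gamma act_vert act_edge act_square.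

Definition vertex_transitive Gamma : Prop :=
  forall v w : vert building, exists2 g, Gamma g & act_vert g v = w.

Definition discrete_subgroup Gamma : Prop :=
  exists U : set PGLxPGL, [/\ open U, U 1%g & U `&` Gamma `<=` [set 1%g]].

Local Notation borel := (g_sigma_algebraType (open : set (set PGLxPGL))).

Definition haar_measure (R : realType) (mu : {measure set borel -> \bar R}) :
    Prop :=
  [/\ forall (g : PGLxPGL) (A : set borel), measurable A ->
        mu [set (g * x)%g | x in A] = mu A,
      forall A : set PGLxPGL, compact A -> (mu A < +oo)%E
    & forall U : set PGLxPGL, open U -> U !=set0 -> (0 < mu U)%E].

(* Finite covolume: some Borel set of finite Haar measure meets every orbit of
   Gamma acting by left translations. *)
Definition is_lattice (R : realType) Gamma : Prop :=
  [/\ subgroup Gamma, discrete_subgroup Gamma &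
      exists (mu : {measure set borel -> \bar R}) (F : set borel),
        [/\ haar_measure mu, measurable F, (mu F < +oo)%E
          & forall g : PGLxPGL, exists2 c, Gamma c & F (c * g)%g]].

(* (Gamma /\ G_1)(Gamma /\ G_2) has infinite index in Gamma, where G_1 and G_2
   are the two factors. *)
Definition irreducible_lattice Gamma : Prop :=
  ~ finite_index
      [set (a * b)%g | a in Gamma `&` [set g : PGLxPGL | g.2 = 1%g]
                     & b in Gamma `&` [set g : PGLxPGL | g.1 = 1%g]] Gamma.

Definition subring (A : nzRingType) (O : set A) : Prop :=
  [/\ O 1, forall x y, O x -> O y -> O (x - y)
    & forall x y, O x -> O y -> O (x * y)].

(* For a number field k, these are k itself and the valuation rings of the
   finite places of k. *)
Definition valuation_ring (k : fieldType) (V : set k) : Prop :=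
  subring V /\ forall x, V x \/ V x^-1.

Definition place_ring (l : nat) (L : padicField l) (k : fieldType)
    (s : {rmorphism k -> L}) : set k := [set a | pnorm (s a) <= 1].

(* The ring of elements of k that are integral at all finite places other than
   the ones induced by s and t *)
Definition S_integers (k : fieldType) (s : {rmorphism k -> Kp})
    (t : {rmorphism k -> Kq}) : set k :=
  [set a | forall V, valuation_ring V -> V <> place_ring s ->
           V <> place_ring t -> V a].

Definition quaternion_algebra (k : fieldType) (D : falgType k) : Prop :=
  [/\ \dim {:D} = 4%N,
      forall x : D, (forall y, x * y = y * x) -> exists a : k, x = a%:A
    & forall I : {vspace D}, (forall x y, y \in I -> x * y \in I /\ y * x \in I) ->
        I = 0%VS \/ I = fullv].

(* k is totally real and D is ramified at every real place of k. *)
Definition totally_definite (k : fieldType) (D : falgType k) : Prop :=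
  forall s : {rmorphism k -> algC},
    (forall a, s a \is Num.real) /\
    ~ exists f : {rmorphism D -> 'M[algC]_2},
        (forall a : k, f a%:A = (s a)%:M) /\
        (forall x i j, f x i j \is Num.real).

Definition is_order (k : fieldType) (A : set k) (D : falgType k) (O : set D) :
    Prop :=
  [/\ subring O,
      forall a x, A a -> O x -> O (a *: x),
      forall x, exists a : k, a != 0 /\ O (a *: x)
    & exists gens : seq D, forall x, O x -> exists c : nat -> k,
        (forall i, A (c i)) /\ x = \sum_(i < size gens) c i *: gens`_i].

Definition represents (l : nat) (L : padicField l) (A : 'M[L]_2) (g : PGL2 L) :
    Prop := exists u : GL2 L, val u = A /\ pgl_of u = g.

(* By the classification of the forms of PGL_2, the irreducible arithmetic
   lattices of PGL_2(Q_p) x PGL_2(Q_q) are the subgroups commensurable with the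
   image of the unit group of an S-order of a quaternion algebra D over a number
   field k, where S consists of two finite places with completions Q_p and Q_q
   at which D splits, and D is ramified at all the archimedean places. *)
Definition is_arithmetic Gamma : Prop :=
  exists (k : fieldExtType rat) (D : falgType k)
    (s : {rmorphism k -> Kp}) (t : {rmorphism k -> Kq})
    (f : {rmorphism D -> 'M[Kp]_2}) (g : {rmorphism D -> 'M[Kq]_2})
    (O : set D),
    [/\ quaternion_algebra D /\ totally_definite D,
        place_ring s <> place_ring t,
        (forall a : k, f a%:A = (s a)%:M) /\ (forall a : k, g a%:A = (t a)%:M),
        is_order (S_integers s t) O
      & commensurable Gamma
          [set h : PGLxPGL | exists x y : D,
             [/\ O x, O y, x * y = 1 & y * x = 1] /\
             represents (f x) h.1 /\ represents (g x) h.2]].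

End Lattices.

(* Main.v *)
Require Import Defs.
From mathcomp Require Import all_boot all_order all_algebra all_field.
From mathcomp Require Import all_classical all_reals all_analysis.
From mathcomp Require Import ring.

(* A torsion free discrete group Gamma acts freely on the vertices of the building: the
   powers of an element fixing a vertex repeat modulo every p^k and q^l, so some nontrivial
   power is close to 1, hence trivial. As Gamma is transitive on vertices, an edge x of Sigma
   issued from the unique vertex is the same thing as an element g_x of Gamma moving the base
   vertex (u0, w0) to a neighbor, and the square with sides x, q gives the relation
   g_q g_(lambda(x, q)) = g_x g_(pi(x, q)). Words in horizontal edges code the paths of T_h
   issued from u0, and by this relation the state q acts on them as g_q^-1, where g_q fixes u0.
   Two facts then give freeness. First, an element of Gamma acting trivially on T_h is trivial:
   its first component is 1, so a power of it comes from a unit of the quaternion order that is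
   scalar in M_2(Q_p), hence central because D is simple, hence has trivial second component.
   Second, T_v is a tree, so that a reduced word in the g_q moves w0. *)

Set Implicit Arguments.
Unset Strict Implicit.
Unset Printing Implicit Defensive.

Import Order.TTheory GRing.Theory Num.Theory.

Local Open Scope classical_set_scope.

(** * Freeness of automaton groups *)

(** The obstacle is that the automaton sees only [T_h], while freeness is read off [T_v]: an element
    of Gamma must not be lost in its action on [T_h], and this is where arithmeticity enters. The
    alphabet contains each horizontal edge together with its inverse, so words code paths that may
    backtrack, and a word is recovered only from the endpoints of all its prefixes. The generators
    come in inverse pairs. The criterion for freeness therefore works with words in a symmetric set
    without involutions, where cancellation just means that two neighbors have product 1; a basis is
    extracted at the end by choosing one generator out of each pair. Torsion freeness is used three
    times: for stabilizers to be trivial, for the absence of inversions, without which the quotient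
    would not be a square complex, and for the absence of involutions among the generators. *)

Lemma prodg_rev_inv (G : groupType) (s : seq G) :
  (\prod_(x <- rev [seq x^-1 | x <- s]) x = (\prod_(x <- s) x)^-1)%g.
Proof.
elim: s => [|x s IH]; first by rewrite !big_nil invg1.
by rewrite big_cons invgM -IH /= rev_cons -cats1 big_cat big_seq1.
Qed.

Section FreeCriterion.
Context (G : groupType) (S : set G).
Local Open Scope group_scope.

(** Reduced words over a set closed under inversion: no signs are needed, as the inverse of a letter
    is a letter. *)
Definition nonbacktracking (w : seq G) := sorted (fun a b => a * b != 1) w.

Hypothesis S_inv : forall b, S b -> S b^-1.
Hypothesis S_square : forall b, S b -> b * b <> 1.
Hypothesis S_free : forall w : seq G, w <> [::] -> (forall a, a \in w -> S a) ->
  nonbacktracking w -> \prod_(a <- w) a <> 1.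

(* One element out of each pair {b, b^-1} *)
Let B : set G := [set b | S b /\ b = xget 1 [set c | c = b \/ c = b^-1]].

Let letter (a : G * bool) := if a.2 then a.1 else a.1^-1.

Lemma word_val_letter w : word_val w = \prod_(a <- map letter w) a.
Proof.
by rewrite big_map; elim: w => [|a w IH]; rewrite ?big_nil // big_cons /= IH.
Qed.

(** [xget] depends only on the set {b, b^-1}, so b and b^-1 share one chosen element. *)
Lemma half_or b : S b -> B b \/ B b^-1.
Proof.
move=> Sb; set P := [set c | c = b \/ c = b^-1].
have e : [set c | c = b^-1 \/ c = b^-1^-1] = P.
  by rewrite invgK; apply/seteqP; split=> c; rewrite /P /= => -[]; tauto.
have : P (xget 1 P) by apply: (xgetPex 1); exists b; left.
case=> h; [left|right]; split; rewrite ?e //; exact: S_inv.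
Qed.

(** Otherwise b and b^-1 would both be the chosen element, and b would have square 1. *)
Lemma half_inv b : B b -> ~ B b^-1.
Proof.
move=> [Sb eb] [_ eb']; apply: (S_square Sb).
suff e : b = b^-1 by rewrite {2}e mulgV.
apply: etrans eb _; apply: etrans (esym eb'); congr (xget 1 _).
by rewrite invgK; apply/seteqP; split=> c /=; tauto.
Qed.

Lemma letter_in a : B a.1 -> S (letter a).
Proof. by case: a => b [] /= [Sb _] //; exact: S_inv. Qed.

Lemma letter_inj a a' : B a.1 -> B a'.1 -> letter a = letter a' -> a = a'.
Proof.
case: a a' => [b []] [b' []]; rewrite /letter /= => Bb Bb' e.
- by rewrite e.
- by case: (half_inv Bb'); rewrite -e.
- by case: (half_inv Bb); rewrite e.
- by rewrite (invg_inj e).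
Qed.

Lemma reduced_nonbacktracking w :
  reduced_word B w -> nonbacktracking (map letter w).
Proof.
move=> [Bw sw]; rewrite /nonbacktracking sorted_map.
have Bw' : all [pred a : G * bool | `[< B a.1 >]] w.
  by apply/allP => a /Bw Ba; apply/asboolP.
apply: (sub_in_sorted _ Bw') sw => a b /asboolP Ba /asboolP Bb /=; apply: contra.
rewrite mulg_eq1 => /eqP e.
have <- : (b.1, ~~ b.2) = a; last by rewrite /= !eqxx; case: b.2.
apply: letter_inj => //; rewrite e /letter /=; case: b.2 => //=.
by rewrite invgK.
Qed.

Lemma generatedP h : generated S h ->
  exists2 w : seq G, (forall a, a \in w -> S a) & h = \prod_(a <- w) a.
Proof.
pose W : set G := [set h | exists2 w : seq G, (forall a, a \in w -> S a)
                                & h = \prod_(a <- w) a].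
apply: (@smallest_sub _ _ _ W) => [|a Sa].
  split; first by exists [::]; rewrite ?big_nil.
  move=> _ _ [u Su ->] [v Sv ->]; exists (u ++ rev [seq x^-1 | x <- v]).
    move=> a; rewrite mem_cat => /orP[/Su //|].
    by rewrite mem_rev => /mapP[b /Sv Sb ->]; exact: S_inv.
  by rewrite big_cat prodg_rev_inv.
exists [:: a]; last by rewrite big_seq1.
by move=> b; rewrite inE => /eqP ->.
Qed.

Lemma reduced_exists w : (forall a : G, a \in w -> S a) ->
  exists2 u, reduced_word B u & word_val u = \prod_(a <- w) a.
Proof.
elim: w => [|s w IH] Sw.
  by exists [::]; rewrite ?big_nil //; split.
have [u [Bu su] eu] : exists2 u, reduced_word B u & word_val u = \prod_(a <- w) a.
  by apply: IH => a aw; apply: Sw; rewrite inE aw orbT.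
have [a Ba sa] : exists2 a, B a.1 & letter a = s.
  have [|Bs|Bs] := @half_or s; first by apply: Sw; rewrite inE eqxx.
    by exists (s, true).
  by exists (s^-1, false); rewrite // /letter /= invgK.
rewrite big_cons -eu -sa.
case: u Bu su eu => [|b u] Bu su eu.
  by exists [:: a] => //; split=> // c; rewrite inE => /eqP ->.
have Bu' : forall c, c \in u -> B c.1 by move=> c cu; apply: Bu; rewrite inE cu orbT.
have [/andP[/eqP e1 e2]|ne] := boolP ((a.1 == b.1) && (a.2 != b.2)).
  exists u; first by split=> //; exact: path_sorted su.
  rewrite /word_val /= mulgA /letter e1 -/(word_val u).
  by case: a.2 b.2 e2 => -[] //= _; rewrite ?mulgV ?mulVg mul1g.
exists (a :: b :: u); last by [].
by split; [move=> c; rewrite inE => /predU1P[-> //|/Bu]|rewrite /= ne].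
Qed.

Lemma reduced_unique w w' : reduced_word B w -> reduced_word B w' ->
  word_val w = word_val w' -> w = w'.
Proof.
have ne1 u : u <> [::] -> reduced_word B u -> word_val u <> 1.
  move=> u0 ru; rewrite word_val_letter; apply: S_free.
  - by case: u u0 {ru}.
  - by move=> a /mapP[b bu ->]; apply: letter_in; apply: ru.1.
  - exact: reduced_nonbacktracking.
elim: w w' => [|a w IH] [|a' w'] rw rw' e //.
- by case: (ne1 _ _ rw').
- by case: (ne1 _ _ rw).
have [ea|ne] := eqVneq a a'.
  rewrite ea in rw e *; congr (_ :: _); apply: IH.
  - split; last by case: rw => _; exact: path_sorted.
    by move=> c cw; apply: rw.1; rewrite inE cw orbT.
  - split; last by case: rw' => _; exact: path_sorted.
    by move=> c cw; apply: rw'.1; rewrite inE cw orbT.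
  - exact: mulgI e.
(* The first letters differ, so the inverse of the first word followed by the second does not
   backtrack at the junction. Its product is 1, against [S_free]. *)
pose u := rev [seq x^-1 | x <- map letter (a :: w)].
have su : nonbacktracking (u ++ map letter (a' :: w')).
  rewrite /u /= rev_cons cat_rcons /nonbacktracking sorted_cat_cons /=.
  rewrite -rev_cons rev_sorted /=; apply/and3P; split.
  - rewrite -[path _ _ _]/(sorted _ [seq x^-1 | x <- map letter (a :: w)]).
    rewrite sorted_map; apply: sub_sorted (reduced_nonbacktracking rw) => x y.
    by rewrite /relpre /= -invgM invg_eq1.
  - apply: contra ne; rewrite mulg_eq1 => /eqP/invg_inj e'.
    by apply/eqP/letter_inj => //; [apply: rw.1|apply: rw'.1]; rewrite inE eqxx.
  - exact: reduced_nonbacktracking rw'.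
case: (S_free _ _ su).
- by rewrite /u /= rev_cons; case: (rev _).
- move=> b; rewrite mem_cat mem_rev => /orP[/mapP[_ /mapP[c cw ->] ->]|].
    by apply/S_inv/letter_in; apply: rw.1.
  by move=> /mapP[c cw ->]; apply: letter_in; apply: rw'.1.
- have e2 : \prod_(i <- map letter (a' :: w')) i = \prod_(i <- map letter (a :: w)) i.
    by rewrite -!word_val_letter.
  rewrite big_cat e2.
  by rewrite prodg_rev_inv; exact: mulVg.
Qed.

Lemma free_subgroup_generated : free_subgroup (generated S).
Proof.
exists B; split.
  move=> w [Bw _] H [[H1 Hdiv] SH].
  have HV x : H x -> H x^-1 by move=> Hx; rewrite -div1g; exact: Hdiv.
  elim: w Bw => [|a w IH] Bw //=.
  suff : H (letter a / (word_val w)^-1) by rewrite invgK.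
  apply: Hdiv; last first.
    by apply/HV/IH => b bw; apply: Bw; rewrite inE bw orbT.
  by apply: SH; apply: letter_in; apply: Bw; rewrite inE eqxx.
move=> h /generatedP[w Sw ->]; have [u ru eu] := reduced_exists Sw.
exists u; split=> // v [rv ev]; apply: reduced_unique => //.
by rewrite eu ev.
Qed.

End FreeCriterion.

(** * Automata acting on coded paths *)

Section FreeAutomaton.
Context (A : automaton) (G : groupType) (U : Type) (act : G -> U -> U) (u0 : U).
Context (gx : alphabet A -> G) (gq : state A -> G).
Local Open Scope group_scope.

Hypothesis actM : forall g h u, act (g * h) u = act g (act h u).
Hypothesis act1 : forall u, act 1 u = u.
Hypothesis gq_fix : forall q, act (gq q) u0 = u0.
Hypothesis gx_inj : forall x y, act (gx x) u0 = act (gx y) u0 -> x = y.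
(* the boundary of the square with sides x and q at the base vertex *)
Hypothesis square_rel : forall x q,
  gq q * gx (out x q) = gx x * gq (trans x q).
Hypothesis gq_inv : forall q, exists q', gq q' = (gq q)^-1.

Let hol (w : seq (alphabet A)) : G := \prod_(x <- w) gx x.

Hypothesis gq_faithful : forall s : seq (state A),
  (forall w, act ((\prod_(q <- s) gq q) * hol w) u0 = act (hol w) u0) ->
  \prod_(q <- s) gq q = 1.
Hypothesis gq_square : forall q, gq q * gq q <> 1.
Hypothesis gq_free : forall s : seq (state A), s <> [::] ->
  nonbacktracking (map gq s) -> \prod_(q <- s) gq q <> 1.

Lemma actK g : cancel (act g) (act g^-1).
Proof. by move=> u; rewrite -actM mulVg act1. Qed.

Lemma size_automaton_map (q : state A) w : size (automaton_map q w) = size w.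
Proof. by elim: w q => //= x w IH q; rewrite IH. Qed.

Lemma take_automaton_map (q : state A) n w :
  take n (automaton_map q w) = automaton_map q (take n w).
Proof. by elim: w n q => [|x w IH] [|n] q //=; rewrite IH. Qed.

(* On the paths from u0, coded by words, the state q acts as (gq q)^-1. *)
Lemma hol_automaton_map q w :
  act (gq q) (act (hol (automaton_map q w)) u0) = act (hol w) u0.
Proof.
rewrite -actM; suff [q' ->] : exists q', gq q * hol (automaton_map q w) = hol w * gq q'.
  by rewrite actM gq_fix.
elim: w q => [|x w IH] q; first by exists q; rewrite /hol !big_nil mul1g mulg1.
have [q' e] := IH (trans x q); exists q'.
by rewrite /hol /= !big_cons mulgA square_rel -mulgA [X in _ * X]e mulgA.
Qed.

(** A path that may backtrack is not determined by its endpoint, but it is by the endpoints of all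
    its prefixes. *)
Lemma hol_inj w w' : size w = size w' ->
  (forall n, act (hol (take n w)) u0 = act (hol (take n w')) u0) -> w = w'.
Proof.
elim: w w' => [|x w IH] [|x' w'] //= [sw] e.
have ex : x = x'.
  apply: gx_inj; have := e 1%N.
  by rewrite /= !take0 /hol !big_seq1.
rewrite -ex; congr (_ :: _); apply: IH => // n; have := e n.+1.
rewrite /= -ex /hol !big_cons !actM => /(congr1 (act (gx x)^-1)).
by rewrite !actK.
Qed.

(** An automaton map commutes with taking prefixes, so it suffices to compare endpoints, on which
    the two states act by inverse elements. *)
Lemma automaton_mapK q q' : gq q' * gq q = 1 ->
  cancel (automaton_map q) (automaton_map q').
Proof.
move=> e w; apply: hol_inj; first by rewrite !size_automaton_map.
move=> n; rewrite !take_automaton_map -(hol_automaton_map q (take n w)).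
rewrite -(hol_automaton_map q' (automaton_map q (take n w))) -actM.
by rewrite -{1}[gq q]invgK -(mulg1_eq e) invgK mulVg act1.
Qed.

Lemma automaton_invertible : invertible A.
Proof.
move=> q; have [q' e] := gq_inv q; exists (automaton_map q').
  by apply: automaton_mapK; rewrite e mulVg.
by apply: automaton_mapK; rewrite e mulgV.
Qed.

Lemma automaton_group_free : free_subgroup (automaton_group A).
Proof.
have states (w : seq (bijection (seq (alphabet A)))) :
    (forall b, b \in w -> exists q, bij_fun b =1 automaton_map q) ->
  exists2 s : seq (state A), size s = size w & forall q0 b0 i, (i < size w)%N ->
    bij_fun (nth b0 w i) =1 automaton_map (nth q0 s i).
  elim: w => [|b w IH] Sw; first by exists [::].
  have [q bq] := Sw b (mem_head _ _).
  have [|s ss sP] := IH; first by move=> c cw; apply: Sw; rewrite inE cw orbT.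
  exists (q :: s); first by rewrite /= ss.
  by move=> q0 b0 [|i] //=; exact: sP.
have inj1 (b c : bijection (seq (alphabet A))) q q' :
    bij_fun b =1 automaton_map q -> bij_fun c =1 automaton_map q' ->
    gq q' * gq q = 1 -> c * b = 1.
  move=> bq cq e; apply: bijection_eq => w /=.
  by rewrite bq cq automaton_mapK.
have main (w : seq (bijection (seq (alphabet A)))) : w <> [::] ->
    (forall b, b \in w -> exists q, bij_fun b =1 automaton_map q) ->
    nonbacktracking w -> \prod_(b <- w) b <> 1.
  move=> w0 Sw nbw prod1; have [s ss sP] := states _ Sw.
  have s0 : rev s <> [::].
    by move/(congr1 size); rewrite size_rev ss; case: w w0 {Sw nbw prod1 ss sP}.
  (* Each state acts by the inverse of its [gq], hence a product of bijections acts by the inverse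
     of the product of the [gq] in reverse order. *)
  have hol_prod v : act (\prod_(q <- rev s) gq q)
      (act (hol (bij_fun (\prod_(b <- w) b) v)) u0) = act (hol v) u0.
    elim: w s ss sP v {w0 Sw nbw prod1 s0} => [|b w IH] [|q s] //= => [_ _ v|[ss] sP v].
      by rewrite !big_nil act1.
    rewrite rev_cons -cats1 big_cat big_seq1 actM big_cons /=.
    rewrite (sP q b 0%N) //= hol_automaton_map.
    by apply: IH => // q0 b0 i; exact: (sP q0 b0 i.+1).
  have e1 : \prod_(q <- rev s) gq q = 1.
    by apply: gq_faithful => v; rewrite actM -[RHS]hol_prod prod1.
  apply: gq_free e1 => //; case: s ss sP s0 {hol_prod} => // q0 s' + + _.
  move: (q0 :: s') => {}s ss sP.
  rewrite /nonbacktracking map_rev rev_sorted.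
  (* If two consecutive [gq] cancelled, so would the two bijections, by [inj1]. *)
  apply/(sortedP 1) => i; rewrite size_map => hi.
  rewrite !(nth_map q0) //; last exact: ltnW.
  move/(sortedP 1): nbw => /(_ i); rewrite -ss => /(_ hi).
  apply: contra_neq => /mulg1_eq e.
  apply: inj1 (sP q0 1 i.+1 _) (sP q0 1 i _) _; rewrite -?ss ?(ltnW hi) //.
  by rewrite -e mulVg.
apply: free_subgroup_generated.
- move=> b [q bq]; have [q' e] := gq_inv q; exists q' => w /=.
  rewrite -{1}(automaton_mapK (q := q') (q' := q) _ w) ?e ?mulgV //.
  by rewrite -bq (bij_funK b).
- move=> b [q bq] bb.
  have /gq_faithful : forall v, act ((\prod_(q <- [:: q; q]) gq q) * hol v) u0 =
      act (hol v) u0.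
    move=> v; rewrite big_cons big_seq1 actM actM -{1}[v]/(bij_fun 1 v) -bb /= !bq.
    by rewrite !hol_automaton_map.
  by rewrite big_cons big_seq1; exact: gq_square.
- exact: main.
Qed.

End FreeAutomaton.

(** * The p-adic norm and lattices *)

Local Open Scope ring_scope.

Section PadicNorm.
Context (p : nat) (K : padicField p).
Implicit Types (x y : K) (n k : nat).

Let p_prime := padic_prime K.

Lemma pnorm0 : pnorm (0 : K) = 0.
Proof. by apply/eqP; rewrite pnorm_eq0. Qed.

Lemma pnorm1 : pnorm (1 : K) = 1.
Proof. by rewrite (pnorm_nat K (ltn0Sn 0)) logn1 expr0 invr1. Qed.

Lemma pnormN x : pnorm (- x) = pnorm x.
Proof.
rewrite -mulN1r pnormM.
suff -> : pnorm (-1 : K) = 1 by rewrite mul1r.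
have := pnormM (-1 : K) (-1); rewrite mulrNN mulr1 pnorm1 => /esym/eqP.
by rewrite -expr2 sqrp_eq1 ?pnorm_ge0 // => /eqP.
Qed.

Lemma pnormB x y : pnorm (x - y) <= Num.max (pnorm x) (pnorm y).
Proof. by rewrite -(pnormN y); exact: pnormD. Qed.

Lemma pnormD_le x y e : pnorm x <= e -> pnorm y <= e -> pnorm (x + y) <= e.
Proof. by move=> hx hy; rewrite (le_trans (pnormD _ _)) // ge_max hx. Qed.

Lemma pnormB_le x y e : pnorm x <= e -> pnorm y <= e -> pnorm (x - y) <= e.
Proof. by move=> hx hy; apply: pnormD_le => //; rewrite pnormN. Qed.

Lemma pnorm_sum_le (I : Type) (r : seq I) (P : pred I) (F : I -> K) e : 0 <= e ->
  (forall i, P i -> pnorm (F i) <= e) -> pnorm (\sum_(i <- r | P i) F i) <= e.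
Proof.
move=> e0 h; elim/big_rec: _ => [|i x Pi hx]; first by rewrite pnorm0.
by apply: pnormD_le => //; exact: h.
Qed.

Lemma pnormX x n : pnorm (x ^+ n) = pnorm x ^+ n.
Proof. by elim: n => [|n IH]; rewrite ?expr0 ?pnorm1 // !exprS pnormM IH. Qed.

Lemma pnormV x : pnorm x^-1 = (pnorm x)^-1.
Proof.
have [->|x0] := eqVneq x 0; first by rewrite invr0 pnorm0 invr0.
apply: (mulfI (x := pnorm x)); first by rewrite pnorm_eq0.
by rewrite -pnormM !mulfV ?pnorm1 // pnorm_eq0.
Qed.

Lemma pnormM_le1 x y e : pnorm x <= 1 -> pnorm y <= e -> pnorm (x * y) <= e.
Proof.
move=> hx hy; rewrite pnormM (le_trans _ hy) // -[leRHS]mul1r.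
by rewrite ler_wpM2r ?pnorm_ge0.
Qed.

Lemma pnorm_p : pnorm (p%:R : K) = p%:R^-1.
Proof.
rewrite pnorm_nat ?prime_gt0 //; have := pfactorK 1 p_prime.
by rewrite expn1 => ->; rewrite expr1.
Qed.

Lemma p_gt0 : 0 < p%:R :> rat.
Proof. by rewrite ltr0n prime_gt0. Qed.

Lemma pnorm_p_lt1 : p%:R^-1 < 1 :> rat.
Proof. by rewrite invf_lt1 ?p_gt0 // ltr1n prime_gt1. Qed.

Lemma pnorm_nat_le1 n : pnorm (n%:R : K) <= 1.
Proof.
case: n => [|n]; first by rewrite pnorm0.
rewrite pnorm_nat // invf_le1 ?exprn_gt0 ?p_gt0 // exprn_ege1 //.
by rewrite ler1n prime_gt0.
Qed.

Lemma pnorm_dvd k n : (p ^ k %| n)%N -> pnorm (n%:R : K) <= p%:R ^- k.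
Proof.
move=> /dvdnP[m ->]; rewrite natrM natrX; apply: pnormM_le1 (pnorm_nat_le1 m) _.
by rewrite pnormX pnorm_p exprVn.
Qed.

Lemma pnorm_lt1_dvd n : pnorm (n%:R : K) < 1 -> (p %| n)%N.
Proof.
case: n => [|n] // h; move: h; rewrite pnorm_nat //.
have [->|] := posnP (logn p n.+1); first by rewrite expr0 invr1 ltxx.
by rewrite logn_gt0 mem_primes => /and3P[].
Qed.

Lemma padic_nat_neq0 n : (0 < n)%N -> n%:R != 0 :> K.
Proof.
move=> n0; rewrite -pnorm_eq0 pnorm_nat // invr_eq0 expf_neq0 //.
by rewrite gt_eqF ?p_gt0.
Qed.

(** By density x may be replaced by a rational a/b in lowest terms; it is integral, so b is prime to
    p and can be inverted modulo p^k. *)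
Lemma padic_residue k x : pnorm x <= 1 ->
  exists2 n, (n < p ^ k)%N & pnorm (x - n%:R) <= p%:R ^- k.
Proof.
move=> x1; have pk0 : 0 < p%:R ^- k :> rat by rewrite invr_gt0 exprn_gt0 ?p_gt0.
have pk1 : p%:R ^- k <= 1 :> rat.
  by rewrite invf_le1 ?exprn_gt0 ?p_gt0 // exprn_ege1 // ler1n prime_gt0.
have [r xr] := pnorm_dense x pk0.
have r1 : pnorm (ratr r : K) <= 1.
  rewrite -[ratr r](subKr x); apply: pnormB_le => //.
  exact: le_trans (ltW xr) pk1.
suff [m rm] : exists m : nat, pnorm (ratr r - m%:R : K) <= p%:R ^- k.
  exists (m %% p ^ k)%N; first by rewrite ltn_mod expn_gt0 prime_gt0.
  rewrite -(subrK (ratr r) x) -addrA; apply: pnormD_le; first exact: ltW.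
  rewrite -(subrK m%:R (ratr r)) -addrA; apply: pnormD_le => //.
  rewrite {1}(divn_eq m (p ^ k)) natrD addrK natrM natrX.
  apply: pnormM_le1 (pnorm_nat_le1 _) _.
  by rewrite pnormX pnorm_p exprVn.
pose a := `|numq r|%N; pose b := `|denq r|%N.
have b0 : (0 < b)%N by rewrite absz_gt0 denq_neq0.
have bK := padic_nat_neq0 b0.
have [sgn er] : exists s : bool, ratr r = (-1) ^+ s * (a%:R / b%:R) :> K.
  exists (numq r < 0); rewrite /ratr mulrA; congr (_ / _).
    by rewrite {1}[numq r]intEsign rmorphM rmorphXn rmorphN1.
  by rewrite {1}[denq r]intEsign ltNge (ltW (denq_gt0 r)) expr0 mul1r.
suff [m rm] : exists m : nat, pnorm (a%:R / b%:R - m%:R : K) <= p%:R ^- k.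
  rewrite er; case: sgn {er}; last by exists m; rewrite expr0 mul1r.
  (* A natural number congruent to -m modulo p^k. *)
  exists (m * (p ^ k).-1)%N; rewrite expr1 mulN1r.
  have -> : - (a%:R / b%:R) - (m * (p ^ k).-1)%:R =
      - (a%:R / b%:R - m%:R) - (m * p ^ k)%:R :> K.
    rewrite -{2}(@prednK (p ^ k)) ?expn_gt0 ?prime_gt0 // mulnS natrD; ring.
  by apply: pnormB_le; rewrite ?pnormN // pnorm_dvd // dvdn_mull.
(* If p divided b, integrality of the fraction would force p to divide a as well. *)
have bp : coprime b (p ^ k).
  rewrite coprime_sym; apply: coprimeXl; rewrite prime_coprime //; apply/negP => pb.
  have : (p %| a)%N.
    apply: pnorm_lt1_dvd; rewrite -(divfK bK a%:R) pnormM.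
    have -> : pnorm (a%:R / b%:R : K) = pnorm (ratr r : K).
      by rewrite er; case: (sgn); rewrite ?mulN1r ?pnormN ?mul1r.
    apply: le_lt_trans pnorm_p_lt1; rewrite -[leRHS]mul1r.
    apply: ler_pM; rewrite ?pnorm_ge0 //.
    by rewrite -[p%:R^-1]/(p%:R ^- 1); apply: pnorm_dvd; rewrite expn1.
  move=> pa; have := coprime_num_den r; rewrite /coprime => /eqP cab.
  have : (p %| gcdn `|numq r| `|denq r|)%N by rewrite dvdn_gcd pa.
  by rewrite cab dvdn1 => /eqP p1; move: p_prime; rewrite p1.
have [[u v] /= uv] := coprimeP _ b0 bp.
(* By Bezout u b = 1 + v p^k, so u inverts b modulo p^k. *)
exists (a * u)%N.
have -> : a%:R / b%:R - (a * u)%:R = a%:R / b%:R * (1 - (u * b)%:R) :> K.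
  by rewrite !natrM; field.
have -> : (u * b)%N = (1 + v * p ^ k)%N by rewrite -uv subnK // ltnW // -subn_gt0 uv.
rewrite natrD opprD addrA subrr sub0r; apply: pnormM_le1.
  by move: r1; rewrite er; case: (sgn); rewrite ?mulN1r ?pnormN ?mul1r.
by rewrite pnormN pnorm_dvd // dvdn_mull.
Qed.

(** Discreteness of the valuation: the residue of x modulo p is divisible by p and smaller than p,
    so it is 0. *)
Lemma pnorm_lt1_le x : pnorm x < 1 -> pnorm x <= p%:R^-1.
Proof.
move=> x1; have [n np xn] := padic_residue 1 (ltW x1).
rewrite expn1 in np; rewrite expr1 in xn.
have : (p %| n)%N.
  apply: pnorm_lt1_dvd; rewrite -[n%:R](subKr x).
  by rewrite (le_lt_trans (pnormB _ _)) // gt_max x1 (le_lt_trans xn) ?pnorm_p_lt1.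
rewrite /dvdn modn_small // => /eqP n0; by rewrite n0 subr0 in xn.
Qed.

Lemma pnorm_p_inv x : pnorm (p%:R^-1 * x) = p%:R * pnorm x.
Proof. by rewrite pnormM pnormV pnorm_p invrK. Qed.

End PadicNorm.

(** * Integral matrices and lattices in K^2 *)

Section Lattices.
Context (p : nat) (K : padicField p).

Definition integral_mx m n (M : 'M[K]_(m, n)) := forall i j, pnorm (M i j) <= 1.

Lemma integral_mxM m n k (M : 'M[K]_(m, n)) (N : 'M[K]_(n, k)) :
  integral_mx M -> integral_mx N -> integral_mx (M *m N).
Proof.
move=> iM iN i j; rewrite mxE; apply: pnorm_sum_le => // l _.
exact: pnormM_le1.
Qed.

Lemma integral_mxD m n (M N : 'M[K]_(m, n)) :
  integral_mx M -> integral_mx N -> integral_mx (M + N).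
Proof. by move=> iM iN i j; rewrite mxE; exact: pnormD_le. Qed.

Lemma integral_mxZ m n (c : K) (M : 'M[K]_(m, n)) :
  pnorm c <= 1 -> integral_mx M -> integral_mx (c *: M).
Proof. by move=> c1 iM i j; rewrite mxE; exact: pnormM_le1. Qed.

Lemma integral_mx1 n : integral_mx (1%:M : 'M[K]_n).
Proof. by move=> i j; rewrite mxE; case: eqP; rewrite ?pnorm1 ?pnorm0. Qed.

Lemma lattice_ofP (A : 'M[K]_2) x : A \in unitmx ->
  lattice_of A x <-> integral_mx (invmx A *m x).
Proof.
move=> Au; split=> [[y iy <-]|ix]; first by rewrite mulKmx.
by exists (invmx A *m x); rewrite ?mulKVmx.
Qed.

Lemma lattice_ofD (A : 'M[K]_2) x y :
  lattice_of A x -> lattice_of A y -> lattice_of A (x + y).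
Proof.
move=> [x' ix <-] [y' iy <-]; exists (x' + y'); last by rewrite mulmxDr.
exact: integral_mxD.
Qed.

Lemma lattice_ofZ (A : 'M[K]_2) c x :
  pnorm c <= 1 -> lattice_of A x -> lattice_of A (c *: x).
Proof.
move=> c1 [x' ix <-]; exists (c *: x'); last by rewrite scalemxAr.
exact: integral_mxZ.
Qed.

Lemma lattice_of_sub (A B : 'M[K]_2) : B \in unitmx ->
  lattice_of A `<=` lattice_of B <-> integral_mx (invmx B *m A).
Proof.
move=> Bu; split=> [AB i j|iBA _ [x ix <-]].
  have : lattice_of A (A *m delta_mx j 0).
    exists (delta_mx j 0) => // a b; rewrite mxE.
    by case: (_ && _); rewrite ?pnorm1 ?pnorm0.
  move=> /AB/(lattice_ofP _ Bu)/(_ i 0).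
  by rewrite mulmxA -colE mxE.
by apply/lattice_ofP => //; rewrite mulmxA; exact: integral_mxM.
Qed.

(* m and n are independent modulo p, since n is nonzero and m is no multiple of n. *)
Lemma lattice_span2 (A : 'M[K]_2) (m n : 'cV[K]_2) (N : set 'cV[K]_2) :
  A \in unitmx ->
  (forall x y, N x -> N y -> N (x + y)) ->
  (forall c x, pnorm c <= 1 -> N x -> N (c *: x)) ->
  [set p%:R *: x | x in lattice_of A] `<=` N ->
  lattice_of A m -> lattice_of A n ->
  ~ [set p%:R *: x | x in lattice_of A] n -> N n -> ~ N m ->
  forall x, lattice_of A x ->
  exists a b : K, [/\ pnorm a <= 1, pnorm b <= 1 & x = a *: m + b *: n].
Proof.
move=> Au ND NZ pN [m' im <-] [n' in_ <-] nPn Nn nNm _ [x' ix <-].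
have pL (y : 'cV[K]_2) : (forall k, pnorm (y k (0 : 'I_1)) < 1) ->
    [set p%:R *: x | x in lattice_of A] (A *m y).
  move=> hy; have pK := padic_p_neq0 K.
  exists (A *m (p%:R^-1 *: y)); last by rewrite -scalemxAr scalerA mulfV ?scale1r.
  exists (p%:R^-1 *: y) => // k l; rewrite ord1 mxE pnorm_p_inv.
  by rewrite -ler_pdivlMl ?p_gt0 // mulr1 pnorm_lt1_le.
have [i ni] : exists i, pnorm (n' i 0) = 1.
  have [//|nex] := pselect (exists i, pnorm (n' i 0) = 1).
  case: nPn; apply: pL => k; rewrite lt_neqAle in_ andbT.
  by apply/eqP => e; apply: nex; exists k.
have n0 : n' i 0 != 0 by rewrite -pnorm_eq0 ni oner_eq0.
have [j ij] : exists j : 'I_2, forall k, k = i \/ k = j.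
  exists (i + 1); move=> k; case: (i) (k) => [[|[|//]] ?] [[|[|//]] ?];
    by [left; apply: val_inj|right; apply: val_inj].
(* The determinant of m' and n'. If p divided it, m would be a multiple of n modulo p times the
   lattice, hence would lie in [N]. *)
pose d := m' i 0 * n' j 0 - m' j 0 * n' i 0.
have d1 : pnorm d = 1.
  apply/eqP; rewrite eq_le; apply/andP; split.
    by apply: pnormB_le; exact: pnormM_le1.
  rewrite leNgt; apply/negP => dlt; apply: nNm.
  have -> : m' = (m' - (m' i 0 / n' i 0) *: n') + (m' i 0 / n' i 0) *: n' by rewrite subrK.
  rewrite mulmxDr; apply: ND; last first.
    rewrite -scalemxAr; apply: NZ => //.
    by rewrite pnormM pnormV ni invr1 mulr1.
  apply: pN; apply: pL => k; rewrite !mxE; have [->|->] := ij k.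
    by rewrite divfK // subrr pnorm0.
  have -> : m' j 0 - m' i 0 / n' i 0 * n' j 0 = - (d / n' i 0) by rewrite /d; field.
  by rewrite pnormN pnormM pnormV ni invr1 mulr1.
have d0 : d != 0 by rewrite -pnorm_eq0 d1 oner_eq0.
(* Cramer's rule; the coefficients are integral since d is a unit. *)
exists ((x' i 0 * n' j 0 - x' j 0 * n' i 0) / d), ((m' i 0 * x' j 0 - m' j 0 * x' i 0) / d).
split.
- by rewrite pnormM pnormV d1 invr1 mulr1; apply: pnormB_le; exact: pnormM_le1.
- by rewrite pnormM pnormV d1 invr1 mulr1; apply: pnormB_le; exact: pnormM_le1.
rewrite !scalemxAr -mulmxDr; congr (_ *m _); apply/matrixP => k l; rewrite ord1 !mxE.
apply: (mulIf d0); rewrite mulrDl mulrAC divfK // [_ / d * _ * d]mulrAC divfK //.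
by have [->|->] := ij k; rewrite /d; ring.
Qed.

End Lattices.

(** * The action of PGL_2 on the vertices of its tree *)

Section Action.
Context (p : nat) (K : padicField p).
Local Notation GL2 := (GL2 K).
Local Notation PGL2 := (PGL2 K).
Local Notation bt_vertex := (bt_vertex K).
Implicit Types (U V W : bt_vertex) (g h : PGL2).

Lemma bt_vertex_eq U V : proj1_sig U = proj1_sig V -> U = V.
Proof.
case: U V => [U hU] [V hV] /= e; subst V; congr exist; exact: Prop_irrelevance.
Qed.

Lemma homothety_class_eq (A B : 'M[K]_2) (c : K) : c != 0 ->
  lattice_of B = lattice_of (c *: A) -> homothety_class B = homothety_class A.
Proof.
move=> c0 e; have eq d : lattice_of (d *: B) = lattice_of ((d * c) *: A).
  by rewrite -scale_lattice_of e scale_lattice_of scalerA.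
apply/seteqP; split=> _ [d /= d0 <-].
  by exists (d * c); rewrite /= ?mulf_neq0 // -eq.
by exists (d / c); rewrite /= ?mulf_neq0 ?invr_eq0 // eq divfK.
Qed.

Lemma bt_vertexP V L : proj1_sig V L ->
  exists A, [/\ A \in unitmx, L = lattice_of A & proj1_sig V = homothety_class A].
Proof.
have [A [Au eV]] := proj2_sig V; rewrite eV => -[c /= c0 <-].
exists (c *: A); split=> //; first by rewrite unitmxZ // unitfE.
by rewrite (homothety_class_eq c0 (erefl _)).
Qed.

Lemma bt_vertex_meet U V L : proj1_sig U L -> proj1_sig V L -> U = V.
Proof.
move=> /bt_vertexP[A [_ -> eA]] /bt_vertexP[B [_ e eB]].
apply: bt_vertex_eq; rewrite eA eB; apply: (@homothety_class_eq _ _ 1).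
  exact: oner_neq0.
by rewrite scale1r.
Qed.

Lemma bt_vertexZ V L (c : K) : c != 0 -> proj1_sig V L ->
  proj1_sig V [set c *: x | x in L].
Proof.
move=> c0 /bt_vertexP[A [_ -> ->]]; exists c => //=; by rewrite scale_lattice_of.
Qed.

(** Another matrix of the same class differs from [pgl_rep] by a scalar, which permutes the lattices
    of a homothety class. *)
Lemma bt_actE (A : GL2) V : proj1_sig (bt_act (pgl_of A) V) =
  [set [set val A *m x | x in L] | L in proj1_sig V].
Proof.
rewrite /bt_act /=; have [c [c0 ->]] := pgl_of_repP A.
have h (d : K) (B : 'M[K]_2) L V0 : d != 0 -> proj1_sig V0 L ->
    [set [set B *m x | x in L] | L in proj1_sig V0] [set (d *: B) *m x | x in L].
  move=> d0 VL; exists [set d *: x | x in L]; first exact: bt_vertexZ.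
  by rewrite image_comp; apply: eq_imagel => x _ /=; rewrite -scalemxAl scalemxAr.
apply/seteqP; split=> _ [L VL <-]; first exact: h.
have := h c^-1 (c *: val A) L V; rewrite scalerA mulVf // scale1r invr_eq0.
exact.
Qed.

Lemma bt_actM g h V : bt_act (g * h)%g V = bt_act g (bt_act h V).
Proof.
rewrite -(pgl_repK g) -(pgl_repK h).
rewrite -[(_ * _)%g]/(pgl_mul (pgl_of (pgl_rep g)) (pgl_of (pgl_rep h))) pgl_ofM.
apply: bt_vertex_eq; rewrite !bt_actE image_comp; apply: eq_imagel => L _ /=.
by rewrite image_comp; apply: eq_imagel => x _ /=; rewrite mulmxA.
Qed.

Lemma bt_act1 V : bt_act 1%g V = V.
Proof.
apply: bt_vertex_eq; rewrite -[1%g]/(pgl_of (gl_one K)) bt_actE.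
rewrite -[RHS]image_id; apply: eq_imagel => L _ /=.
by rewrite -[RHS]image_id; apply: eq_imagel => x _ /=; rewrite mul1mx.
Qed.

Definition bt0 : bt_vertex :=
  exist (fun V : set (set 'cV[K]_2) => exists A, A \in unitmx /\ V = homothety_class A)
    (homothety_class (1%:M : 'M[K]_2))
    (ex_intro _ 1%:M (conj (unitmx1 _ _) erefl)).

(** A matrix of g maps the standard lattice to a multiple c of it; dividing by c gives a matrix in
    GL_2(Z_p). *)
Lemma bt_stab_integral g : bt_act g bt0 = bt0 ->
  exists A : GL2, [/\ pgl_of A = g, integral_mx (val A) & integral_mx (invmx (val A))].
Proof.
move=> gV; set A := pgl_rep g.
have : proj1_sig (bt_act (pgl_of A) bt0) (lattice_of (val A)).
  rewrite bt_actE; exists (lattice_of 1%:M); last by rewrite mul_lattice_of mulmx1.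
  by exists 1; rewrite /= ?oner_neq0 // scale1r.
rewrite pgl_repK gV => -[c /= c0 cA].
have Bu : c^-1 *: val A \in unitmx by rewrite unitmxZ ?unitfE ?invr_eq0 // (valP A).
exists (Sub (c^-1 *: val A) Bu : GL2).
have e : lattice_of (c^-1 *: val A) = lattice_of 1%:M.
  by rewrite -scale_lattice_of -cA scale_lattice_of scalerA mulVf // scale1r.
split.
- by rewrite -(pgl_repK g); apply/pgl_ofP; exists c^-1; rewrite invr_eq0.
- have [/(_ _)/= + _] := lattice_of_sub (c^-1 *: val A) (unitmx1 K 2).
  by rewrite invmx1 mul1mx; apply; rewrite e.
- have [/(_ _)/= + _] := lattice_of_sub 1%:M Bu.
  by rewrite mulmx1; apply; rewrite e.
Qed.

End Action.

(** * Acyclicity of the Bruhat-Tits tree *)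

Section Tree.
Context (p : nat) (K : padicField p).
Local Notation bt_vertex := (bt_vertex K).
Local Notation adjacent := Defs.adjacent.
Local Notation pscale L := [set p%:R *: x | x in L].
Implicit Types (U V W : bt_vertex) (L M : set 'cV[K]_2).

Lemma bt_vertex_scale V L M : proj1_sig V L -> proj1_sig V M ->
  exists2 c : K, c != 0 & M = [set c *: x | x in L].
Proof.
have [A [Au ->]] := proj2_sig V => -[c /= c0 <-] [d /= d0 <-].
exists (d / c); first by rewrite mulf_neq0 ?invr_eq0.
by rewrite scale_lattice_of scalerA divfK.
Qed.

Lemma adjacent_at U V L : adjacent U V -> proj1_sig U L ->
  exists M, [/\ proj1_sig V M, M `<` L & pscale L `<` M].
Proof.
move=> [L' [M' [UL' VM' ML LM]]] UL.
have [c c0 eL] := bt_vertex_scale UL' UL.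
have cI : injective (fun x : 'cV[K]_2 => c *: x) by apply: can_inj (scalerK c0).
exists [set c *: x | x in M']; split; first exact: bt_vertexZ.
  by rewrite eL; exact: Defs.proper_image.
suff -> : pscale L = [set c *: x | x in pscale L'] by exact: Defs.proper_image.
rewrite eL !image_comp; apply: eq_imagel => x _ /=.
by rewrite !scalerA mulrC.
Qed.

(** The path lifts to a descending chain of lattices starting at [L0]. That its last term [M] is not
    inside p [L0] means that [L0] / [M] is cyclic; this is what the absence of backtracking
    preserves, and it prevents [M] from being homothetic to [L0]. *)
Lemma bt_path_descends (V : nat -> bt_vertex) L0 n :
  proj1_sig (V 0%N) L0 ->
  (forall i, (i <= n)%N -> adjacent (V i) (V i.+1)) ->
  (forall i, (i < n)%N -> V i.+2 <> V i) ->
  exists L M, [/\ proj1_sig (V n) L /\ proj1_sig (V n.+1) M,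
    pscale L `<` M /\ M `<` L, L `<=` L0, M `<` L0
    & ~ M `<=` pscale L0].
Proof.
move=> VL0; elim: n => [|n IH] adj nb.
  have [M [VM ML LM]] := adjacent_at (adj 0%N (leqnn _)) VL0.
  by exists L0, M; split=> //; case: LM.
have [||L [M [[VL VM] [LM ML] LL0 ML0 nM]]] := IH.
- by move=> i ilen; apply: adj; exact: leqW.
- by move=> i iltn; apply: nb; exact: leqW.
have [N [VN NM MN]] := adjacent_at (adj n.+1 (leqnn _)) VM.
exists M, N; split=> //.
- exact: subset_trans ML.1 LL0.
- split; first exact: subset_trans NM.1 ML0.1.
  by move=> L0N; apply: ML0.2; apply: subset_trans NM.1.
(* [N] and p [L] both lie strictly between p [M] and [M], and they differ because the path does not
   backtrack. So together they span [M]; as both are inside p [L0], so would be [M]. The two cases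
   below depend on which of them contains a vector outside the other. *)
move=> NpL0; apply: nM.
have p0 := padic_p_neq0 K.
have pI (X Y : set 'cV[K]_2) : X `<=` Y -> pscale X `<=` pscale Y.
  by move=> XY; exact: image_subset.
have pI' (X Y : set 'cV[K]_2) : pscale X `<=` pscale Y -> X `<=` Y.
  move=> XY x Xx; have [|y Yy /(scalerI p0) <-//] := XY (p%:R *: x).
  by exists x.
have pLat (X : set 'cV[K]_2) W : proj1_sig W X -> exists2 B : 'M[K]_2,
    B \in unitmx & pscale X = lattice_of B.
  move=> /(bt_vertexZ p0)/bt_vertexP[B [Bu eB _]].
  by exists B.
have [A [Au eA _]] := bt_vertexP VM.
have [B [Bu eB _]] := bt_vertexP VN.
have [C Cu eC] := pLat _ _ VL.
have [D Du eD] := pLat _ _ VL0.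
have pLpL0 := pI _ _ LL0.
have comb a b x y : pnorm a <= 1 -> pnorm b <= 1 ->
    pscale L0 x -> pscale L0 y -> pscale L0 (a *: x + b *: y).
  by rewrite eD => *; apply: lattice_ofD; exact: lattice_ofZ.
have [NpL|/existsNP[x /not_implyP[Nx pLx]]] := pselect (N `<=` pscale L).
- have : ~ pscale L `<=` N.
    move=> pLN; apply: (nb n) => //; apply: bt_vertex_meet VN _.
    have <- : pscale L = N by apply/seteqP.
    exact: bt_vertexZ.
  move=> /existsNP[x /not_implyP[pLx Nx]].
  have /existsNP[y /not_implyP[Ny pMy]] := MN.2.
  have := @lattice_span2 p K A x y N Au; rewrite -eA => span z Mz.
  suff [a [b [a1 b1 ->]]] : exists a b : K,
      [/\ pnorm a <= 1, pnorm b <= 1 & z = a *: x + b *: y].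
    by apply: comb => //; [exact: pLpL0|exact: NpL0].
  apply: span => //.
  + by rewrite eB => ? ?; exact: lattice_ofD.
  + by rewrite eB => ? ?; exact: lattice_ofZ.
  + exact: MN.1.
  + exact: LM.1.
  + exact: NM.1.
- have /existsNP[y /not_implyP[pLy pMy]] : ~ pscale L `<=` pscale M.
    by move/pI'; exact: ML.2.
  have := @lattice_span2 p K A x y (pscale L) Au; rewrite -eA => span z Mz.
  suff [a [b [a1 b1 ->]]] : exists a b : K,
      [/\ pnorm a <= 1, pnorm b <= 1 & z = a *: x + b *: y].
    by apply: comb => //; [exact: NpL0|exact: pLpL0].
  apply: span => //.
  + by rewrite eC => ? ?; exact: lattice_ofD.
  + by rewrite eC => ? ?; exact: lattice_ofZ.
  + exact: pI ML.1.
  + exact: NM.1.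
  + exact: LM.1.
Qed.

(** If the path closed up, the last lattice would be c [L0]. It would contain [L0] if c has norm at
    least 1; otherwise the norm of c is at most 1/p, and it would be inside p [L0]. *)
Lemma bt_acyclic (V : nat -> bt_vertex) n :
  (forall i, (i <= n)%N -> adjacent (V i) (V i.+1)) ->
  (forall i, (i < n)%N -> V i.+2 <> V i) -> V n.+1 <> V 0%N.
Proof.
move=> adj nb e; have [A [Au eV]] := proj2_sig (V 0%N).
have VL0 : proj1_sig (V 0%N) (lattice_of A).
  by rewrite eV; exists 1; rewrite /= ?oner_neq0 // scale1r.
have [L [M [[_ VM] _ _ ML0 nM]]] := bt_path_descends VL0 adj nb.
rewrite e in VM; have [c c0 eM] := bt_vertex_scale VL0 VM.
have [c1|c1] := leP 1 (pnorm c).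
  apply: ML0.2 => x L0x; rewrite eM; exists (c^-1 *: x).
    by apply: lattice_ofZ => //; rewrite pnormV invf_le1 // (lt_le_trans _ c1).
  by rewrite scalerA mulfV // scale1r.
apply: nM; rewrite eM => _ [x L0x <-]; have p0 := padic_p_neq0 K.
exists ((p%:R^-1 * c) *: x); last by rewrite scalerA mulVKf.
apply: lattice_ofZ => //; rewrite pnorm_p_inv.
by rewrite -ler_pdivlMl ?(p_gt0 K) // mulr1 pnorm_lt1_le.
Qed.

Lemma adjacent_irr V : ~ adjacent V V.
Proof. by move=> a; apply: (@bt_acyclic (fun=> V) 0). Qed.

End Tree.

(** * Freeness of the action *)

Section Residues.
Context (p : nat) (K : padicField p).

(** Reduction modulo p^k with values in a finite type, for use with the pigeonhole principle. The
    successor in [(p ^ k).+1] makes this type visibly inhabited; nonintegral entries get the default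
    [ord0]. *)
Lemma residue_code (k m n : nat) : exists c : 'M[K]_(m, n) -> 'M['I_(p ^ k).+1]_(m, n),
  forall M, integral_mx M -> forall i j, pnorm (M i j - (c M i j)%:R) <= p%:R ^- k.
Proof.
have h (x : K) : exists r : 'I_(p ^ k).+1, pnorm x <= 1 -> pnorm (x - r%:R) <= p%:R ^- k.
  have [/(padic_residue k)[r rp xr]|x1] := boolP (pnorm x <= 1); last by exists ord0.
  by exists (inord r); rewrite inordK // ltnW.
exists (fun M => \matrix_(i, j) projT1 (cid (h (M i j)))) => M iM i j.
by rewrite mxE; case: cid => r /= ->.
Qed.

Lemma pnorm_small (e : rat) : 0 < e -> exists k, p%:R ^- k < e.
Proof.
move=> e0; have [k ek] : exists k : nat, e^-1 < k%:R.
  exists (Num.bound e^-1); have := archi_boundP (ltW (_ : 0 < e^-1)).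
  by rewrite invr_gt0; apply.
exists k; rewrite -[e]invrK ltf_pV2 ?posrE ?invr_gt0 ?exprn_gt0 ?(p_gt0 K) //.
apply: (lt_trans ek); rewrite -natrX ltr_nat.
by apply: ltn_expl; exact: prime_gt1 (padic_prime K).
Qed.

Lemma integral_mxX n (A : 'M[K]_2) : integral_mx A -> integral_mx (A ^+ n).
Proof.
move=> iA; elim: n => [|n IH]; first by rewrite expr0; exact: integral_mx1.
by rewrite exprS; exact: integral_mxM.
Qed.

(** Multiplication by A^-i, which is integral, preserves congruences modulo p^k. *)
Lemma integral_power_close (k i j : nat) (A : 'M[K]_2) : A \in unitmx ->
  integral_mx (invmx A) -> (i <= j)%N ->
  (forall a b, pnorm ((A ^+ i - A ^+ j) a b) <= p%:R ^- k) ->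
  forall a b, pnorm ((A ^+ (j - i) - 1%:M) a b) <= p%:R ^- k.
Proof.
move=> Au iA ij h a b; rewrite -pnormN.
have -> : - (A ^+ (j - i) - 1%:M) a b = ((invmx A) ^+ i *m (A ^+ i - A ^+ j)) a b.
  have AA : (invmx A) ^+ i *m A ^+ i = 1%:M.
    have -> : invmx A = A^-1 by [].
    rewrite -[_ *m _]/(_ * _) exprVn mulVr //; exact: unitrX.
  rewrite mulmxBr AA -{2}(subnKC ij) exprD -[X in _ *m X]/(_ *m _) mulmxA AA mul1mx.
  by rewrite !mxE opprB.
rewrite mxE; apply: pnorm_sum_le => [|c _].
  by rewrite invr_ge0 exprn_ge0 ?(ltW (p_gt0 K)).
by apply: pnormM_le1 (h c b); apply: integral_mxX.
Qed.

End Residues.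

Lemma pigeonhole_nat (T : finType) (f : nat -> T) : exists i j, (i < j)%N /\ f i = f j.
Proof.
have /injectivePn[x [y xy e]] : ~~ injectiveb (fun i : 'I_#|T|.+1 => f i).
  by apply/negP => /injectiveP/leq_card; rewrite card_ord ltnn.
by case: (ltngtP x y) xy => [h _|h _|/val_inj -> /eqP//];
  [exists x, y|exists y, x].
Qed.

(** * Discrete torsion free groups act freely on vertices *)

Section FreeAction.
Context (p q : nat) (Kp : padicField p) (Kq : padicField q).
Local Notation PGLxPGL := (PGL2 Kp * PGL2 Kq)%type.
Context (Gamma : set PGLxPGL).

Hypothesis Gamma_sub : subgroup Gamma.
Hypothesis Gamma_discrete : discrete_subgroup Gamma.
Hypothesis Gamma_tf : torsion_free_subgroup Gamma.
Hypothesis Gamma_trans : vertex_transitive Gamma.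

Lemma Gamma1 : Gamma 1%g.
Proof. exact: Gamma_sub.1. Qed.

Lemma GammaV g : Gamma g -> Gamma g^-1%g.
Proof. by move=> h; rewrite -div1g; apply: Gamma_sub.2 => //; exact: Gamma1. Qed.

Lemma GammaM g h : Gamma g -> Gamma h -> Gamma (g * h)%g.
Proof. by move=> Gg Gh; rewrite -(invgK h); apply: Gamma_sub.2 => //; exact: GammaV. Qed.

Lemma GammaX g n : Gamma g -> Gamma (g ^+ n)%g.
Proof.
move=> Gg; elim: n => [|n IH]; first by rewrite expg0; exact: Gamma1.
by rewrite expgS; exact: GammaM.
Qed.

Lemma discrete_ball : exists2 e : rat, 0 < e &
  forall (A : GL2 Kp) (B : GL2 Kq),
    (forall i j, pnorm ((val A - 1%:M) i j) < e) ->
    (forall i j, pnorm ((val B - 1%:M) i j) < e) ->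
    Gamma (pgl_of A, pgl_of B) -> (pgl_of A, pgl_of B) = 1%g :> PGLxPGL.
Proof.
have [U [oU U1 UG]] := Gamma_discrete.
have : nbhs (1%g : PGLxPGL) U by apply: open_nbhs_nbhs.
move=> [[V W] /= [nV nW] VW].
move: nV nW; rewrite !nbhsE => -[V' [oV' V'1] V'V] [W' [oW' W'1] W'W].
have [d d0 dV] := oV' (gl_one Kp) V'1.
have [e e0 eW] := oW' (gl_one Kq) W'1.
exists (Num.min d e); first by rewrite lt_min d0.
move=> A B hA hB GAB; apply: UG; split=> //; apply: VW; split=> /=.
  apply/V'V/dV => i j; have := hA i j; rewrite lt_min !mxE => /andP[+ _].
  exact.
apply/W'W/eW => i j; have := hB i j; rewrite lt_min !mxE => /andP[_ +].
exact.
Qed.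

Lemma pgl_of_exp (r : nat) (K : padicField r) (A : GL2 K) n :
  exists2 B : GL2 K, val B = val A ^+ n & pgl_of B = (pgl_of A ^+ n)%g.
Proof.
elim: n => [|n [B eB pB]]; first by exists (gl_one K).
exists (gl_mul A B); first by rewrite /= eB exprS.
by rewrite -pgl_ofM pB expgS.
Qed.

Lemma stabilizer0 g : Gamma g -> act_vert g (bt0 Kp, bt0 Kq) = (bt0 Kp, bt0 Kq) ->
  g = 1%g.
Proof.
case: g => g h Gg fix0.
have [A [pA iA iA']] := bt_stab_integral (congr1 fst fix0).
have [B [pB iB iB']] := bt_stab_integral (congr1 snd fix0).
have [e e0 ball] := discrete_ball.
have [k ke] := pnorm_small Kp e0; have [l le] := pnorm_small Kq e0.
have [c cP] := residue_code Kp k 2 2; have [d dP] := residue_code Kq l 2 2.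
(* The residues in both factors are coded together, so that one pair of exponents serves for
   both. *)
have [i [j [ij [eA eB]]]] :=
  pigeonhole_nat (fun n => (c (val A ^+ n), d (val B ^+ n))).
have close r (K : padicField r) s (f : 'M[K]_2 -> 'M['I_(r ^ s).+1]_2) (C : GL2 K) :
    (forall M, integral_mx M -> forall i j, pnorm (M i j - (f M i j)%:R) <= r%:R ^- s) ->
    integral_mx (val C) -> integral_mx (invmx (val C)) ->
    f (val C ^+ i) = f (val C ^+ j) ->
    forall a b, pnorm ((val C ^+ (j - i) - 1%:M) a b) <= r%:R ^- s.
  move=> fP iC iC' eC; apply: integral_power_close => //; first exact: (valP C).
    exact: ltnW.
  move=> a b; rewrite !mxE -[X in pnorm X](subrKA (f (val C ^+ i) a b)%:R) {2}eC.
  apply: pnormD_le; first by apply: fP; exact: integral_mxX.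
  by rewrite -pnormN opprB; apply: fP; exact: integral_mxX.
have [A' eA' pA'] := pgl_of_exp A (j - i).
have [B' eB' pB'] := pgl_of_exp B (j - i).
apply: (Gamma_tf (n := (j - i)%N) Gg); first by rewrite subn_gt0.
have e1 : ((g, h) ^+ (j - i))%g = (pgl_of A', pgl_of B').
  rewrite pA' pB' pA pB; elim: (j - i)%N => [|n IH]; first by rewrite !expg0.
  by rewrite !expgS IH.
rewrite e1; apply: ball.
- by move=> a b; rewrite eA'; apply: le_lt_trans (close _ _ _ _ _ _ _ _ eA _ _) ke.
- by move=> a b; rewrite eB'; apply: le_lt_trans (close _ _ _ _ _ _ _ _ eB _ _) le.
- by rewrite -e1; exact: GammaX.
Qed.

Lemma act_vertM (g h : PGLxPGL) v : act_vert (g * h)%g v = act_vert g (act_vert h v).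
Proof. by case: g h v => [g g'] [h h'] [v v']; rewrite /act_vert /= !bt_actM. Qed.

Lemma act_vert1 v : act_vert (1%g : PGLxPGL) v = v.
Proof. by case: v => v v'; rewrite /act_vert /= !bt_act1. Qed.

Lemma act_vert_free g h v : Gamma g -> Gamma h -> act_vert g v = act_vert h v -> g = h.
Proof.
move=> Gg Gh e; have [k Gk kv] := Gamma_trans (bt0 Kp, bt0 Kq) v.
apply/eqP; rewrite -divg_eq1; apply/eqP.
have : (k^-1 * (h^-1 * g) * k)%g = 1%g.
  apply: stabilizer0; first by do !apply: GammaM => //; apply: GammaV.
  by rewrite !act_vertM kv e -[act_vert h^-1%g _]act_vertM mulVg act_vert1 -kv
    -act_vertM mulVg act_vert1.
move=> e'; have : (h^-1 * g = 1)%g.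
  by rewrite -[LHS](mulKg k^-1%g) invgK -(mulgK k (k^-1 * _)%g) e' mul1g mulgV.
by move=> /mulg1_eq; rewrite invgK => ->; rewrite mulgV.
Qed.

End FreeAction.

(** * The base vertex *)

Lemma choose_orP (T : Type) (x0 : T) (P : set T) : (exists x, P x) -> P (choose_or x0 P).
Proof. by move=> exP; rewrite /choose_or; case: pselect => // h; case: cid. Qed.

Lemma det_mx22 (R : comNzRingType) (A : 'M[R]_2) :
  \det A = A 0 0 * A 1 1 - A 0 1 * A 1 0.
Proof.
rewrite (expand_det_row _ 0) big_ord_recl big_ord1 /cofactor !det_mx11 !mxE /=.
rewrite expr0 mul1r expr1 mulN1r mulrN.
by congr (_ * A _ _ - A _ _ * A _ _); apply: val_inj.
Qed.

Section BaseVertex.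
Context (p : nat) (K : padicField p).
Local Notation adjacent := Defs.adjacent.
Local Notation bt_vertex := (bt_vertex K).
Local Notation L0 := (lattice_of (1%:M : 'M[K]_2)).

Lemma bt0_lattice : proj1_sig (bt0 K) L0.
Proof. by exists 1; rewrite /= ?oner_neq0 // scale1r. Qed.

Lemma standard_latticeP x : L0 x <-> integral_mx x.
Proof. by rewrite lattice_ofP ?unitmx1 // invmx1 mul1mx. Qed.

Lemma scaled_standard_lattice k (x : 'cV[K]_2) : (forall i j, pnorm (x i j) <= p%:R ^- k.+1) ->
  [set p%:R *: y | y in L0] x.
Proof.
move=> hx; have p0 := padic_p_neq0 K.
exists (p%:R^-1 *: x); last by rewrite scalerA mulfV // scale1r.
apply/standard_latticeP => i j; rewrite mxE pnorm_p_inv.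
rewrite -ler_pdivlMl ?(p_gt0 K) // mulr1 (le_trans (hx i j)) //.
rewrite lef_pV2 ?posrE ?exprn_gt0 ?(p_gt0 K) // -[leLHS]expr1 ler_weXn2l //.
by rewrite ler1n prime_gt0 // (padic_prime K).
Qed.

(** A lattice between p [L0] and [L0] is a union of classes modulo p, hence is determined by the
    finite set of residue codes that it contains. *)
Lemma finite_neighbors : finite_set [set V : bt_vertex | adjacent (bt0 K) V].
Proof.
have [c cP] := residue_code K 1 2 1.
pose T := {set 'M['I_(p ^ 1).+1]_(2, 1)}.
pose inj (m : 'M['I_(p ^ 1).+1]_(2, 1)) : 'cV[K]_2 := \matrix_(i, j) (m i j)%:R.
pose between M := [set p%:R *: y | y in L0] `<` M /\ M `<` L0.
pose P (t : T) (V : bt_vertex) := exists2 M, proj1_sig V M /\ between M &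
   forall m, m \in (t : {set _}) <-> M (inj m).
pose f (t : T) := choose_or (bt0 K) (P t).
apply: (@sub_finite_set _ _ (f @` setT)); last first.
  by apply: finite_image; exact: finite_finset.
move=> V adjV; have [M [VM ML LM]] := adjacent_at adjV bt0_lattice.
pose t : T := [set m | `[< M (inj m) >]]%SET; exists t => //; have : P t (f t).
  apply: choose_orP; exists V, M => // m; rewrite inE.
  by split=> /asboolP.
move=> [N [VN [LN NL]] tN]; apply: bt_vertex_meet (VN) _.
suff -> : N = M by [].
have sub (X Y : set 'cV[K]_2) (W W' : bt_vertex) : between X -> between Y ->
    proj1_sig W X -> proj1_sig W' Y ->
    (forall m, X (inj m) -> Y (inj m)) -> X `<=` Y.
  move=> [LX XL] [LY YL] WX WY XY x Xx.
  have [A [Au eA _]] := bt_vertexP WX; have [B [Bu eB _]] := bt_vertexP WY.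
  have ix : integral_mx x by apply/standard_latticeP/XL.1.
  have px : [set p%:R *: y | y in L0] (x - inj (c x)).
    apply: (@scaled_standard_lattice 0) => i j; rewrite !mxE.
    exact: cP.
  have -> : x = inj (c x) + (x - inj (c x)) by rewrite addrC subrK.
  rewrite eB; apply: lattice_ofD; rewrite -eB; last exact: LY.1.
  apply: XY; have -> : inj (c x) = x + (-1) *: (x - inj (c x)).
    by rewrite scaleN1r opprB addrC subrK.
  rewrite eA; apply: lattice_ofD; first by rewrite -eA.
  by apply: lattice_ofZ; rewrite ?pnormN ?pnorm1 // -eA; exact: LX.1.
have tM m : m \in t <-> M (inj m) by rewrite inE; split=> /asboolP.
by apply/seteqP; split; [apply: (sub _ _ _ _ _ _ VN VM)|apply: (sub _ _ _ _ _ _ VM VN)] => // m;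
  rewrite -tN -tM.
Qed.

(* The lattice spanned by (p^n, 0) and (c, 1); for fixed c these form a ray of the tree. *)
Definition ray_mx (c : K) n : 'M[K]_2 :=
  \matrix_(i, j) if i == 0 then (if j == 0 then p%:R ^+ n else c) else (j == 1)%:R.

Lemma ray_mx_unit c n : ray_mx c n \in unitmx.
Proof.
rewrite unitmxE det_mx22 !mxE /= unitfE mulr1 mulr0 subr0.
by rewrite expf_neq0 // padic_p_neq0.
Qed.

Lemma cV2_eq (x y : 'cV[K]_2) : x 0 0 = y 0 0 -> x 1 0 = y 1 0 -> x = y.
Proof.
move=> h0 h1; apply/matrixP => i j; rewrite ord1.
by case: i => [[|[|//]] hi]; [move: h0|move: h1]; congr (x _ _ = y _ _); apply: val_inj.
Qed.

Lemma cV2_forall (P : 'I_2 -> Prop) : P 0 -> P 1 -> forall i, P i.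
Proof.
move=> h0 h1 [[|[|//]] hi]; [move: h0|move: h1];
  by congr P; apply: val_inj.
Qed.

(** Membership as a congruence: modulo p^n, x is a multiple of (c, 1). The ray thus converges to the
    line spanned by (c, 1). *)
Lemma rayP c n (x : 'cV[K]_2) : pnorm c <= 1 -> lattice_of (ray_mx c n) x <->
  integral_mx x /\ pnorm (x 0 0 - c * x 1 0) <= p%:R ^- n.
Proof.
move=> c1; have pn0 : p%:R ^+ n != 0 :> K by rewrite expf_neq0 // padic_p_neq0.
have pn : pnorm (p%:R ^+ n : K) = p%:R ^- n by rewrite pnormX pnorm_p exprVn.
have coord (y : 'cV[K]_2) : (ray_mx c n *m y) 0 0 = p%:R ^+ n * y 0 0 + c * y 1 0 /\
    (ray_mx c n *m y) 1 0 = y 1 0.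
  split; rewrite mxE big_ord_recl big_ord_recl big_ord0 !mxE /= addr0.
    by congr (_ * y _ _ + _ * y _ _); apply: val_inj.
  by rewrite mul0r add0r mul1r; congr (y _ _); apply: val_inj.
split=> [[y iy <-]|[ix hx]].
  have [-> ->] := coord y; rewrite addrK; split.
    move=> i j; rewrite ord1; move: i; apply: cV2_forall.
      rewrite (coord y).1; apply: pnormD_le; last exact: pnormM_le1.
      apply: pnormM_le1 => //; rewrite -natrX; exact: pnorm_nat_le1.
    by rewrite (coord y).2; exact: iy.
  by rewrite mulrC; apply: pnormM_le1 (iy _ _) _; rewrite pn.
exists (\col_i if i == 0 then (x 0 0 - c * x 1 0) / p%:R ^+ n else x 1 0).
  move=> i j; rewrite mxE; case: eqP => // _.
  by rewrite pnormM pnormV pn invrK -ler_pdivlMr ?exprn_gt0 ?(p_gt0 K) // div1r.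
have [e0 e1] := coord (\col_i if i == 0 then (x 0 0 - c * x 1 0) / p%:R ^+ n else x 1 0).
apply: cV2_eq; first by rewrite e0 !mxE /= mulrC divfK // subrK.
by rewrite e1 !mxE.
Qed.

Definition ray_vertex c n : bt_vertex :=
  exist (fun V : set (set 'cV[K]_2) => exists A, A \in unitmx /\ V = homothety_class A)
    _ (ex_intro _ (ray_mx c n) (conj (ray_mx_unit c n) erefl)).

Lemma ray_vertex_lattice c n : proj1_sig (ray_vertex c n) (lattice_of (ray_mx c n)).
Proof. by exists 1; rewrite /= ?oner_neq0 // scale1r. Qed.

Lemma ray_vertex0 c : pnorm c <= 1 -> ray_vertex c 0 = bt0 K.
Proof.
move=> c1; apply: bt_vertex_meet bt0_lattice.
suff -> : L0 = lattice_of (ray_mx c 0) by exact: ray_vertex_lattice.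
apply/seteqP; split=> x.
  move/standard_latticeP => ix; apply/rayP => //; split=> //.
  by rewrite expr0 invr1; apply: pnormB_le => //; exact: pnormM_le1.
by move/(rayP _ _ c1) => [ix _]; apply/standard_latticeP.
Qed.

(** The direction of the ray, common to all its lattices. *)
Let e1 (c : K) : 'cV[K]_2 := \col_i if i == 0 then c else 1.

Lemma e1_ray c n : pnorm c <= 1 -> lattice_of (ray_mx c n) (e1 c).
Proof.
move=> c1; apply/rayP => //; split.
  by move=> i j; rewrite mxE; case: eqP => // _; rewrite pnorm1.
by rewrite !mxE /= mulr1 subrr pnorm0 invr_ge0 exprn_ge0 ?(ltW (p_gt0 K)).
Qed.

Lemma ray_adjacent c n : pnorm c <= 1 -> adjacent (ray_vertex c n) (ray_vertex c n.+1).
Proof.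
move=> c1; exists (lattice_of (ray_mx c n)), (lattice_of (ray_mx c n.+1)).
have p0 := padic_p_neq0 K.
have pS : p%:R ^- n.+1 = p%:R^-1 * p%:R ^- n :> rat by rewrite -!exprVn exprS.
have plt : p%:R ^- n.+1 < p%:R ^- n :> rat.
  rewrite pS -[ltRHS]mul1r ltr_pM2r ?invr_gt0 ?exprn_gt0 ?(p_gt0 K) //.
  exact: pnorm_p_lt1.
split; try exact: ray_vertex_lattice.
- split=> [x /(rayP _ _ c1)[ix hx]|h].
    by apply/rayP => //; split=> //; exact: le_trans hx (ltW plt).
  (* (p^n, 0) satisfies the congruence modulo p^n but not modulo p^(n+1). *)
  pose z : 'cV[K]_2 := \col_i if i == 0 then p%:R ^+ n else 0.
  have /h/(rayP _ _ c1)[_] : lattice_of (ray_mx c n) z.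
    apply/rayP => //; split.
      by move=> i j; rewrite mxE; case: eqP; rewrite ?pnorm0 // -natrX pnorm_nat_le1.
    by rewrite !mxE /= mulr0 subr0 pnormX pnorm_p exprVn.
  by rewrite !mxE /= mulr0 subr0 pnormX pnorm_p exprVn leNgt plt.
- split=> [_ [x /(rayP _ _ c1)[ix hx] <-]|h].
    apply/rayP => //; split.
      by apply: integral_mxZ => //; exact: pnorm_nat_le1.
    rewrite !mxE mulrCA -mulrBr pnormM pnorm_p pS.
    by rewrite ler_wpM2l // invr_ge0 (ltW (p_gt0 K)).
  (* (c, 1) is in every lattice of the ray but is not p times an integral vector. *)
  have [x /(rayP _ _ c1)[ix _] ex] := h _ (e1_ray n.+1 c1).
  have := congr1 (fun y : 'cV[K]_2 => pnorm (y 1 0)) ex.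
  rewrite !mxE /= pnorm1 pnormM pnorm_p => e.
  have := ix 1 0; rewrite leNgt => /negP; apply.
  rewrite -[ltLHS]e -[ltRHS]mul1r ltr_pM2r ?pnorm_p_lt1 //.
  rewrite lt_neqAle pnorm_ge0 andbT eq_sym; apply/eqP => e0.
  by move: e; rewrite e0 mulr0 => /eqP; rewrite eq_sym oner_eq0.
Qed.

(* An automorphism fixing the rays towards c = 0, 1, p fixes three lines of K^2. *)
Lemma bt_faithful (g : PGL2 K) :
  (forall c n, pnorm c <= 1 -> bt_act g (ray_vertex c n) = ray_vertex c n) -> g = 1%g.
Proof.
move=> fix_ray.
have [|A [pA iA iA']] := @bt_stab_integral p K g.
  by rewrite -(@ray_vertex0 0) ?pnorm0 // fix_ray ?pnorm0.
set M := val A in iA iA'.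
(* The image of (c, 1) satisfies the congruence of the ray modulo every p^n, so it lies on the line
   of (c, 1). *)
have line c : pnorm c <= 1 -> (M *m e1 c) 0 0 = c * (M *m e1 c) 1 0.
  move=> c1; apply/eqP; rewrite -subr_eq0 -pnorm_eq0; apply/eqP/le_anti.
  rewrite pnorm_ge0 andbT leNgt; apply/negP => pos.
  have [n] := pnorm_small K pos; apply/negP; rewrite -leNgt.
  have : proj1_sig (ray_vertex c n) [set M *m x | x in lattice_of (ray_mx c n)].
    rewrite -{1}(fix_ray c n c1) -pA bt_actE.
    by exists (lattice_of (ray_mx c n)) => //; exact: ray_vertex_lattice.
  move=> /(bt_vertex_scale (ray_vertex_lattice c n))[d d0 ed].
  have [y /(rayP _ _ c1)[iy hy] ey] : [set d *: x | x in lattice_of (ray_mx c n)] (M *m e1 c).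
    by rewrite -ed; exists (e1 c) => //; exact: e1_ray.
  (* d (c, 1) is the image under [M] of an integral vector, and its second coordinate is d. *)
  have d1 : pnorm d <= 1.
    have [z /(rayP _ _ c1)[iz _] ez] : [set M *m x | x in lattice_of (ray_mx c n)] (d *: e1 c).
      by rewrite ed; exists (e1 c) => //; exact: e1_ray.
    have := integral_mxM iA iz; rewrite ez => /(_ 1 0).
    by rewrite !mxE /= mulr1.
  by rewrite -ey !mxE mulrCA -mulrBr; exact: pnormM_le1.
have coord c i : (M *m e1 c) i 0 = M i 0 * c + M i 1.
  rewrite mxE big_ord_recl big_ord_recl big_ord0 !mxE /= addr0 mulr1.
  by congr (_ + M _ _); apply: val_inj.
(* Three distinct eigenlines make [M] scalar. The value p is a third one for every p, since p and p
   - 1 are nonzero in K. *)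
have h0 := line 0; have h1 := line 1; have hp := line p%:R.
rewrite !coord pnorm0 mulr0 add0r mul0r in h0.
rewrite !coord pnorm1 !mulr1 mul1r in h1.
rewrite !coord in hp.
have M01 : M 0 1 = 0 by exact: h0.
have {}h1 : M 0 0 = M 1 0 + M 1 1 by rewrite -h1 // M01 addr0.
have M10 : M 1 0 = 0.
  have := hp (pnorm_nat_le1 K p); rewrite M01 addr0 mulrC => /(mulfI (padic_p_neq0 K)).
  rewrite h1 => /addIr/esym/eqP; rewrite -subr_eq0 -[X in _ - X]mulr1 -mulrBr mulf_eq0.
  have p2 := prime_gt1 (padic_prime K).
  have -> : p%:R - 1 = p.-1%:R :> K.
    have -> : p%:R = p.-1.+1%:R :> K by rewrite prednK // ltnW.
    by rewrite -natr1 addrK.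
  rewrite (negPf (@padic_nat_neq0 p K p.-1 _)) ?orbF; first by move/eqP.
  by rewrite -ltnS prednK // ltnW.
rewrite M10 add0r in h1.
rewrite -pA -[1%g]/(pgl_of (gl_one K)); apply/pgl_ofP; exists (M 0 0); split.
  apply/eqP => M00; have := valP A; rewrite unitmxE det_mx22 -/M M00 mul0r M01 mul0r.
  by rewrite subrr unitr0.
rewrite -/M; apply/matrixP => i j; rewrite !mxE.
move: i j; apply: cV2_forall; apply: cV2_forall; rewrite /= ?mulr1 ?mulr0 //.
Qed.

End BaseVertex.

(** * Arithmetic lattices *)

Section Quaternion.
Context (p : nat) (K : padicField p) (k : fieldType) (D : falgType k).
Context (f : {rmorphism D -> 'M[K]_2}).

(** [f] is only a ring morphism, so the coefficients of a linear combination are treated as elements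
    [a%:A] of [D]. *)
Lemma rmorphism_prodv (U V : {vspace D}) : (forall u v, u \in U -> v \in V -> f (u * v) = 0) ->
  forall w, w \in (U * V)%VS -> f w = 0.
Proof.
move=> UV w; rewrite [@prodv _ _]unlock => /coord_span ->.
rewrite rmorph_sum big1 // => i _.
rewrite -mulr_algl rmorphM /=.
set w' := nth _ _ _.
have /allpairsP[[u v] /= [/vbasis_mem Uu /vbasis_mem Vv ->]] :
    w' \in allpairs *%R (vbasis U) (vbasis V).
  by apply: mem_nth; rewrite size_allpairs !size_tuple.
by rewrite UV // mulr0.
Qed.

(** The two-sided ideal D z D lies in the kernel. As [D] is simple, it is 0 or [D], and the latter
    is excluded by f 1 = 1. *)
Lemma quaternion_rmorphism_inj : quaternion_algebra D -> forall z, f z = 0 -> z = 0.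
Proof.
move=> [_ _ simpleD] z fz.
pose I := (fullv * (<[z]> * fullv) : {vspace D})%VS.
have fI : forall w, w \in I -> f w = 0.
  apply: rmorphism_prodv => u v _ Vv; rewrite rmorphM /=.
  suff -> : f v = 0 by rewrite mulr0.
  move: v Vv; apply: rmorphism_prodv => u' v' /vlineP[a ->] _.
  by rewrite -scalerAl -mulr_algl !rmorphM /= fz mul0r mulr0.
have [|I0|I1] := simpleD I.
- move=> x y yI; split.
    have : x * y \in (fullv * I)%VS by apply: memv_mul => //; exact: memvf.
    rewrite /I prodvA; apply/subvP/prodvSl/subvf.
  have : y * x \in (I * fullv)%VS by apply: memv_mul => //; exact: memvf.
  by rewrite /I -!prodvA; apply/subvP/prodvSr/prodvSr/subvf.
- have : 1 * (z * 1) \in I.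
    by rewrite !memv_mul ?memvf ?memv_line.
  by rewrite I0 memv0 mul1r mulr1 => /eqP.
- have /fI : 1 \in I by rewrite I1 memvf.
  by rewrite rmorph1 => /eqP; rewrite oner_eq0.
Qed.

Lemma quaternion_scalar_central : quaternion_algebra D ->
  forall (x : D) (c : K), f x = c%:M -> exists a : k, x = a%:A.
Proof.
move=> qD x c fx; have [_ cent _] := qD; apply: cent => y; apply/eqP.
rewrite -subr_eq0; apply/eqP/(quaternion_rmorphism_inj qD); rewrite rmorphB /=.
have fM u v : f (u * v) = f u *m f v := rmorphM f u v.
by rewrite !fM fx scalar_mxC subrr.
Qed.

End Quaternion.

(** * Matrices representing elements of PGL_2 *)

Section Represents.
Context (l : nat) (L : padicField l).

Lemma representsM (A B : 'M[L]_2) g h :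
  represents A g -> represents B h -> represents (A * B) (g * h)%g.
Proof.
move=> [u [<- <-]] [v [<- <-]]; exists (gl_mul u v); split=> //.
by rewrite -pgl_ofM.
Qed.

Lemma representsV (A B : 'M[L]_2) g : A * B = 1 -> represents A g -> represents B g^-1%g.
Proof.
move=> AB [u [eA <-]]; exists (gl_inv u); split.
  rewrite /= eA -[RHS]mul1mx -(mulVmx (valP u)) eA -mulmxA.
  by rewrite -[A *m B]/(A * B) AB mulmx1.
apply/esym/mulg1_eq; rewrite -[LHS]/(pgl_mul (pgl_of u) (pgl_of (gl_inv u))) pgl_ofM.
by congr pgl_of; apply: val_inj; rewrite /= mulmxV // (valP u).
Qed.

Lemma represents1 (A : 'M[L]_2) : represents A 1%g -> exists c, A = c%:M.
Proof.
move=> [u [<- /pgl_ofP[c [_ ->]]]]; exists c.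
by rewrite /= scale_scalar_mx mulr1.
Qed.

Lemma represents_scalar (c : L) g : represents (c%:M : 'M[L]_2) g -> g = 1%g.
Proof.
move=> [u [eu <-]]; apply/pgl_ofP; exists c; split; last first.
  by rewrite eu /= scale_scalar_mx mulr1.
apply/eqP => c0; have := valP u; rewrite eu c0 raddf0 unitmxE det0.
by rewrite unitr0.
Qed.

End Represents.

(* A power of an element of Gamma acting trivially on the first tree comes from a unit of
   the order that is central modulo the kernel of D -> M_2(Q_p), hence central. *)
Lemma arithmetic_faithful (p q : nat) (Kp : padicField p) (Kq : padicField q)
    (Gamma : set (PGL2 Kp * PGL2 Kq)) :
  subgroup Gamma -> torsion_free_subgroup Gamma -> is_arithmetic Gamma ->
  forall g, Gamma g -> g.1 = 1%g -> g = 1%g.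
Proof.
move=> Gs Gtf [k [D [s [t [f [h [ord [[qD _] _ [_ ht] _ [[r rP] _]]]]]]]]] g Gg g1.
have GX n : Gamma (g ^+ n)%g by exact: GammaX.
set Lam := (X in Gamma `&` X) in rP.
have code n : exists i : 'I_(size r).+1, exists2 x, Lam x & (g ^+ n)%g = (nth 1%g r i * x)%g.
  have [x xr [y [_ yL] e]] := rP _ (GX n).
  exists (inord (index x r)), y => //; rewrite inordK ?ltnS ?index_size //.
  by rewrite nth_index.
(* Two powers of g in the same left coset of a subgroup made of images of units: their quotient is
   represented by the unit a' b. *)
have [i [j [ij eij]]] := pigeonhole_nat (fun n => projT1 (cid (code n))).
have [x Lx ex] := projT2 (cid (code i)); have [y Ly ey] := projT2 (cid (code j)).
have exy : (g ^+ (j - i))%g = (x^-1 * y)%g.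
  rewrite expgnFr; last exact: ltnW.
  have gij : (g ^+ j * g ^- i = g ^- i * g ^+ j)%g.
    by rewrite -[in LHS](subnK (ltnW ij)) -[in RHS](subnKC (ltnW ij)) !expgnDr mulgK mulKg.
  by rewrite gij ex ey eij invgM -!mulgA mulKg.
have [a [a' [[_ _ aa' a'a] [fa ha]]]] := Lx.
have [b [b' [[_ _ bb' b'b] [fb hb]]]] := Ly.
have frep : represents (f (a' * b)) (g ^+ (j - i))%g.1.
  rewrite exy rmorphM; apply: representsM => //; apply: representsV fa.
  by rewrite -rmorphM aa' rmorph1.
have hrep : represents (h (a' * b)) (g ^+ (j - i))%g.2.
  rewrite exy rmorphM; apply: representsM => //; apply: representsV ha.
  by rewrite -rmorphM aa' rmorph1.
have gn1 n : (g ^+ n)%g.1 = 1%g.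
  by elim: n => // n IH; rewrite expgS -[LHS]/(g.1 * (g ^+ n).1)%g IH g1 mulg1.
apply: (Gtf g (j - i)%N) => //; first by rewrite subn_gt0.
have [c fc] : exists c, f (a' * b) = c%:M.
  by apply: represents1; rewrite -(gn1 (j - i)%N).
have [d ed] : exists d : k, a' * b = d%:A.
  exact: quaternion_scalar_central qD _ _ fc.
rewrite ed ht in hrep.
rewrite [LHS]surjective_pairing gn1; congr pair.
exact: represents_scalar hrep.
Qed.

(** * The quotient complex *)

Section OrbitTheory.
Context (G : groupType) (T : Type) (act : G -> T -> T) (H : set G).
Local Open Scope group_scope.
Hypothesis actM : forall g h x, act (g * h) x = act g (act h x).
Hypothesis act1 : forall x, act 1 x = x.
Hypothesis subH : subgroup H.

Lemma orbit_ofP x y : orbit_of act H x = orbit_of act H y <-> exists2 g, H g & act g x = y.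
Proof.
have [H1 Hdiv] := subH.
have HV g : H g -> H g^-1 by move=> Hg; rewrite -div1g; exact: Hdiv.
split=> [/(congr1 (@proj1_sig _ _)) /= e|[g Hg <-]].
  by have : Defs.orbit act H y y; [exists 1|rewrite -e].
suff e : Defs.orbit act H x = Defs.orbit act H (act g x).
  rewrite /orbit_of; move: (ex_intro _ (act g x) _) => P; move: P; rewrite -e => P.
  congr exist; exact: Prop_irrelevance.
apply/seteqP; split=> _ [h Hh <-].
  by exists (h / g); [exact: Hdiv|rewrite -actM divgK].
by exists (h * g); [rewrite -[g]invgK; apply: Hdiv => //; exact: HV|rewrite actM].
Qed.

Lemma orbit_repK (O : orbits act H) : orbit_of act H (orbit_rep O) = O.
Proof.
case: O => O hO; rewrite /orbit_rep /=; case: cid => x /= e.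
rewrite /orbit_of; move: hO; rewrite e => hO; congr exist; exact: Prop_irrelevance.
Qed.

Lemma orbit_rep_of x : exists2 g, H g & act g x = orbit_rep (orbit_of act H x).
Proof. by apply/orbit_ofP; rewrite orbit_repK. Qed.

End OrbitTheory.

Section Quotient.
Context (p q : nat) (Kp : padicField p) (Kq : padicField q).
Local Notation PGLxPGL := (PGL2 Kp * PGL2 Kq)%type.
Context (Gamma : set PGLxPGL).

Hypothesis Gamma_sub : subgroup Gamma.
Hypothesis Gamma_discrete : discrete_subgroup Gamma.
Hypothesis Gamma_tf : torsion_free_subgroup Gamma.
Hypothesis Gamma_trans : vertex_transitive Gamma.

Local Notation adjacent := Defs.adjacent.
Local Notation Sigma := (building_quotient Gamma).
Local Notation X := (building Kp Kq).
Local Notation u0 := (bt0 Kp).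
Local Notation w0 := (bt0 Kq).
Implicit Types (g h : PGLxPGL).

Let freeV g h v : Gamma g -> Gamma h -> act_vert g v = act_vert h v -> g = h.
Proof. exact: act_vert_free. Qed.

Let GV g : Gamma g -> Gamma g^-1%g.
Proof. exact: GammaV. Qed.

Let GM g h : Gamma g -> Gamma h -> Gamma (g * h)%g.
Proof. exact: GammaM. Qed.

Lemma bt_edge_eq r (K : padicField r) (a b : bt_edge K) :
  (proj1_sig a).1 = (proj1_sig b).1 -> (proj1_sig a).2 = (proj1_sig b).2 -> a = b.
Proof.
case: a b => [[a1 a2] ha] [[b1 b2] hb] /= e1 e2; subst b1 b2.
congr exist; exact: Prop_irrelevance.
Qed.

Lemma bt_acteM r (K : padicField r) (g h : PGL2 K) a :
  bt_acte (g * h)%g a = bt_acte g (bt_acte h a).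
Proof. by apply: bt_edge_eq; rewrite /= bt_actM. Qed.

Lemma bt_acte1 r (K : padicField r) (a : bt_edge K) : bt_acte 1%g a = a.
Proof. by apply: bt_edge_eq; rewrite /= bt_act1. Qed.

Lemma act_edgeM g h (e : edge X) : act_edge (g * h)%g e = act_edge g (act_edge h e).
Proof. by case: e => -[a b]; rewrite /= bt_acteM bt_actM. Qed.

Lemma act_edge1 (e : edge X) : act_edge (1%g : PGLxPGL) e = e.
Proof. by case: e => -[a b]; rewrite /= bt_acte1 bt_act1. Qed.

Lemma act_squareM g h (s : square X) : act_square (g * h)%g s = act_square g (act_square h s).
Proof. by case: s => -[a b] f; rewrite /= !bt_acteM. Qed.

Lemma act_square1 (s : square X) : act_square (1%g : PGLxPGL) s = s.
Proof. by case: s => -[a b] f; rewrite /= !bt_acte1. Qed.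

Local Notation ov := (orbit_of (@act_vert _ _ Kp Kq) Gamma).
Local Notation oe := (orbit_of (@act_edge _ _ Kp Kq) Gamma).
Local Notation os := (orbit_of (@act_square _ _ Kp Kq) Gamma).

Let ovP := orbit_ofP (@act_vertM _ _ Kp Kq) (@act_vert1 _ _ Kp Kq) Gamma_sub.
Let oeP := orbit_ofP act_edgeM act_edge1 Gamma_sub.
Let osP := orbit_ofP act_squareM act_square1 Gamma_sub.
Let ovK := orbit_repK (act := @act_vert _ _ Kp Kq) (H := Gamma).
Let oeK := orbit_repK (act := @act_edge _ _ Kp Kq) (H := Gamma).
Let osK := orbit_repK (act := @act_square _ _ Kp Kq) (H := Gamma).

Lemma src_act g (e : edge X) : src (act_edge g e) = act_vert g (src e).
Proof. by case: e => -[a b]. Qed.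

Lemma einv_act g (e : edge X) : einv (act_edge g e) = act_edge g (einv e).
Proof. by case: e => -[a b]; [congr (inl (_, _))|congr (inr (_, _))]; exact: bt_edge_eq. Qed.

Lemma einvK (e : edge X) : einv (einv e) = e.
Proof. by case: e => -[a b]; [congr (inl (_, _))|congr (inr (_, _))]; exact: bt_edge_eq. Qed.

Lemma side_act g (s : square X) : side (act_square g s) = act_edge g (side s).
Proof. by case: s => -[a b] []. Qed.

Lemma rot_act g (s : square X) : Defs.rot (act_square g s) = act_square g (Defs.rot s).
Proof. by case: s => -[a b] [] /=; congr (_, _, _); exact: bt_edge_eq. Qed.

Lemma flip_act g (s : square X) : flip (act_square g s) = act_square g (flip s).
Proof. by case: s => -[a b] []. Qed.

(** The operations of the quotient are defined on chosen representatives; here and in the next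
    lemmas, equivariance makes them independent of the choice. *)
Lemma einv_orbit (e : edge X) : @einv Sigma (oe e) = oe (einv e).
Proof.
have [g Gg eg] := orbit_rep_of act_edgeM act_edge1 Gamma_sub e.
rewrite -[LHS]/(oe (einv (orbit_rep (oe e)))) -eg einv_act; symmetry.
by apply/oeP; exists g.
Qed.

Lemma side_orbit (s : square X) : @side Sigma (os s) = oe (side s).
Proof.
have [g Gg eg] := orbit_rep_of act_squareM act_square1 Gamma_sub s.
rewrite -[LHS]/(oe (side (orbit_rep (os s)))) -eg side_act; symmetry.
by apply/oeP; exists g.
Qed.

Lemma rot_orbit (s : square X) : @Defs.rot Sigma (os s) = os (Defs.rot s).
Proof.
have [g Gg eg] := orbit_rep_of act_squareM act_square1 Gamma_sub s.
rewrite -[LHS]/(os (Defs.rot (orbit_rep (os s)))) -eg rot_act; symmetry.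
by apply/osP; exists g.
Qed.

Lemma flip_orbit (s : square X) : @flip Sigma (os s) = os (flip s).
Proof.
have [g Gg eg] := orbit_rep_of act_squareM act_square1 Gamma_sub s.
rewrite -[LHS]/(os (flip (orbit_rep (os s)))) -eg flip_act; symmetry.
by apply/osP; exists g.
Qed.

Lemma horizontal_orbit (e : edge X) : @horizontal Sigma (oe e) <-> horizontal e.
Proof.
have [g Gg eg] := orbit_rep_of act_edgeM act_edge1 Gamma_sub e.
rewrite /= -eg; by case: e {eg} => -[].
Qed.

Lemma edge_orbit (E : edge Sigma) : exists e, E = oe e.
Proof. by exists (orbit_rep E); rewrite oeK. Qed.

(* [injection] would unfold bt_act in an equality of edges. *)
Lemma oe_inl a v b w : oe (inl (a, v)) = oe (inl (b, w)) ->
  exists2 g, Gamma g & bt_acte g.1 a = b /\ bt_act g.2 v = w.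
Proof.
move=> /oeP[g Gg /(congr1 (fun e : edge X => if e is inl x then x else (b, w))) e].
by exists g => //; split; [exact: (congr1 fst e)|exact: (congr1 snd e)].
Qed.

Lemma oe_inr a v b w : oe (inr (a, v)) = oe (inr (b, w)) ->
  exists2 g, Gamma g & bt_act g.1 a = b /\ bt_acte g.2 v = w.
Proof.
move=> /oeP[g Gg /(congr1 (fun e : edge X => if e is inr x then x else (b, w))) e].
by exists g => //; split; [exact: (congr1 fst e)|exact: (congr1 snd e)].
Qed.

Lemma square_orbit (S : square Sigma) : exists s, S = os s.
Proof. by exists (orbit_rep S); rewrite osK. Qed.

Lemma one_vertex_Sigma : forall v w : vert Sigma, v = w.
Proof.
move=> v w; rewrite -(ovK v) -(ovK w); apply/ovP.
by have [g Gg e] := Gamma_trans (orbit_rep v) (orbit_rep w); exists g.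
Qed.

(* Gamma acts without inversions since it is torsion free. *)
Lemma no_swap g v w : Gamma g -> act_vert g v = w -> act_vert g w = v -> v = w.
Proof.
move=> Gg e1 e2; rewrite -e1.
suff -> : g = 1%g by rewrite act_vert1.
apply: (Gamma_tf (n := 2) Gg) => //; apply: (freeV (v := v)); first exact: GM.
  by case: Gamma_sub.
by rewrite expg2 act_vertM e1 e2 act_vert1.
Qed.

Lemma bt_edge_neq r (K : padicField r) (a : bt_edge K) :
  (proj1_sig a).1 <> (proj1_sig a).2.
Proof. by case: a => -[u v] /= a e; move: a; rewrite e => /adjacent_irr. Qed.

(** As t is an equivariant involution, g exchanges the base points of s and t s. *)
Lemma square_no_inversion (t : square X -> square X) g (s : square X) : Gamma g ->
  (forall g s, t (act_square g s) = act_square g (t s)) -> (forall s, t (t s) = s) ->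
  act_square g (t s) = s -> src (side (t s)) = src (side s).
Proof.
move=> Gg tact tt e; apply: (@no_swap g) => //; first by rewrite -src_act -side_act e.
by rewrite -src_act -side_act -{1}(tt s) -tact e.
Qed.

Lemma iter_rot_orbit k (s : square X) :
  iter k (@Defs.rot Sigma) (os s) = os (iter k (@Defs.rot X) s).
Proof. by elim: k => // k IH; rewrite !iterS IH rot_orbit. Qed.

Lemma iter_rot_act k g (s : square X) :
  iter k (@Defs.rot X) (act_square g s) = act_square g (iter k (@Defs.rot X) s).
Proof. by elim: k => // k IH; rewrite !iterS IH rot_act. Qed.

Lemma bt_einvK r (K : padicField r) : involutive (@bt_einv r K).
Proof. by move=> a; exact: bt_edge_eq. Qed.

Lemma square_complex_Sigma : is_square_complex Sigma.
Proof.
split.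
- move=> E; have [e ->] := edge_orbit E; rewrite !einv_orbit; split.
    by rewrite einvK.
  move=> /oeP[g Gg ge].
  have s1 : act_vert g (src (einv e)) = src e by rewrite -src_act ge.
  have s2 : act_vert g (src e) = src (einv e).
    by rewrite -{1}(einvK e) -src_act -einv_act ge.
  have := no_swap Gg s1 s2; case: e {ge s1 s2} => -[a b] /=.
    by case=> /esym; exact: bt_edge_neq.
  by case=> /esym; exact: bt_edge_neq.
- move=> S; have [s ->] := square_orbit S.
  rewrite iter_rot_orbit !(flip_orbit, rot_orbit).
  by case: s => -[a b] []; rewrite /= ?bt_einvK.
- move=> S; split; first exact: one_vertex_Sigma.
  have [s ->] := square_orbit S.
  rewrite iter_rot_orbit flip_orbit !side_orbit einv_orbit; congr (oe _).
  by case: s => -[a b] []; rewrite /= ?bt_einvK.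
(* [rot] and [flip] both toggle the boolean, which Gamma preserves, so only the even elements of the
   dihedral group need an argument: rot^2, rot flip and rot^3 flip. These are involutions that move
   the base point. *)
- move=> S k k4; have [s ->] := square_orbit S.
  rewrite flip_orbit !iter_rot_orbit; split.
    move=> /osP[g Gg]; case: k k4 => [//|[|[|[|//]]]] _.
    + by case: s => -[a b] [].
    + pose t := iter 2 (@Defs.rot X).
      move=> e; have : src (side (t s)) = src (side s).
        apply: (square_no_inversion (t := t) Gg _ _ e); first by move=> *; rewrite /t iter_rot_act.
        by case=> -[c d] []; rewrite /t /= ?bt_einvK.
      by case: s {e} => -[a b] [] /=; [move/(congr1 fst)|move/(congr1 fst)] => /esym/bt_edge_neq.
    + by case: s => -[a b] [].
  move=> /osP[g Gg]; case: k k4 => [|[|[|[|//]]]] _.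
  + by case: s => -[a b] [].
  + pose t := fun s : square X => Defs.rot (flip s).
    move=> e; have : src (side (t s)) = src (side s).
      apply: (square_no_inversion (t := t) Gg _ _ e); first by move=> *; rewrite /t flip_act rot_act.
      by case=> -[c d] []; rewrite /t /= ?bt_einvK.
    by case: s {e} => -[a b] [] /=; [move/(congr1 snd)|move/(congr1 fst)] => /esym/bt_edge_neq.
  + by case: s => -[a b] [].
  + pose t := fun s : square X => iter 3 (@Defs.rot X) (flip s).
    move=> e; have : src (side (t s)) = src (side s).
      apply: (square_no_inversion (t := t) Gg _ _ e); first by move=> *; rewrite /t flip_act
        iter_rot_act.
      by case=> -[c d] []; rewrite /t /= ?bt_einvK.
    by case: s {e} => -[a b] [] /=; [move/(congr1 fst)|move/(congr1 snd)] => /esym/bt_edge_neq.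
Qed.

Lemma VHT_complex_Sigma : is_VHT_complex Sigma.
Proof.
split; first split.
- exact: square_complex_Sigma.
- move=> E; have [e ->] := edge_orbit E.
  by rewrite einv_orbit !horizontal_orbit; case: e => -[].
- move=> S; have [s ->] := square_orbit S.
  by rewrite flip_orbit !side_orbit !horizontal_orbit; case: s => -[a b] []; rewrite /=; tauto.
move=> E F _; have [e ->] := edge_orbit E; have [f ->] := edge_orbit F.
rewrite !horizontal_orbit; case: e => // -[a v] _; case: f => [[b u] /(_ I)//|[u b] _].
(* Moves the lift of the vertical edge to the origin of the horizontal one, where the two span a
   square of the building. *)
have [g Gg guv] := Gamma_trans (u, (proj1_sig b).1) ((proj1_sig a).1, v).
have [gu gb] : bt_act g.1 u = (proj1_sig a).1 /\ bt_act g.2 (proj1_sig b).1 = v.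
  by have [] := (congr1 fst guv, congr1 snd guv).
exists (os (a, bt_acte g.2 b, true)); split.
  rewrite flip_orbit !side_orbit; split; first by rewrite /= gb.
  by apply/esym/oeP; exists g; rewrite //= gu.
move=> S [].
have [[[c d] f] ->] := square_orbit S.
rewrite flip_orbit !side_orbit; case: f; last first.
  by move=> /esym/oeP[h _].
move=> /esym/oe_inl[h Gh [hc hd]] /esym/oe_inr[k Gk [kc kd]].
apply/osP; exists h => //=; rewrite hc; congr (_, _, _).
(* Both elements carry the common origin of the two lifted edges to the base point of the other
   square, so they agree by freeness. *)
have -> : h.2 = (k * g^-1)%g.2.
  congr (_.2); apply: (@freeV _ _ ((proj1_sig a).1, v)) => //.
    by apply: GM => //; exact: GV.
  rewrite act_vertM -guv -[act_vert g^-1%g _]act_vertM mulVg act_vert1 guv.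
  by rewrite /act_vert /= kc hd -hc -kd.
by rewrite -bt_acteM /= -[(g.2)^-1%g]/(g^-1%g.2) mulgVK kd.
Qed.

Lemma horizontal_side_rot (S : square Sigma) :
  horizontal (side (Defs.rot S)) <-> ~ horizontal (side S).
Proof.
have [s ->] := square_orbit S.
by rewrite rot_orbit !side_orbit !horizontal_orbit; case: s => -[a b] []; rewrite /=; tauto.
Qed.

Lemma finite_star r (K : padicField r) :
  finite_set [set a : bt_edge K | (proj1_sig a).1 = bt0 K].
Proof.
pose B := (pair (bt0 K)) @` [set V | adjacent (bt0 K) V].
apply: (@sub_finite_set _ _ ((@proj1_sig _ _ : bt_edge K -> _) @^-1` B)).
  move=> [[u v] /= a] e; exists v; rewrite -?e //=.
apply: finite_preimage; last by apply: finite_image; exact: finite_neighbors.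
by move=> a b _ _ e; apply: bt_edge_eq; rewrite e.
Qed.

Lemma finite_complex_Sigma : finite_complex Sigma.
Proof.
have F1 := finite_star Kp; have F2 := finite_star Kq.
split.
- apply: sub_finite_set (finite_set1 (ov (u0, w0))) => v _; exact: one_vertex_Sigma.
- apply: (@sub_finite_set _ _
    (((fun a => oe (inl (a, w0))) @` [set a | (proj1_sig a).1 = u0]) `|`
    ((fun b => oe (inr (u0, b))) @` [set b | (proj1_sig b).1 = w0]))); last first.
    by rewrite finite_setU; split; exact: finite_image.
  move=> E _; have [e ->] := edge_orbit E.
  have [g Gg ge] := Gamma_trans (src e) (u0, w0).
  case: e ge => [[a v]|[u b]] ge; [left; exists (bt_acte g.1 a)|right; exists (bt_acte g.2 b)].
  + exact: (congr1 fst ge).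
  + by apply/esym/oeP; exists g; rewrite //= (congr1 snd ge : bt_act g.2 v = w0).
  + exact: (congr1 snd ge).
  + by apply/esym/oeP; exists g; rewrite //= (congr1 fst ge : bt_act g.1 u = u0).
- apply: (@sub_finite_set _ _ (os @` ([set a | (proj1_sig a).1 = u0] `*`
     [set b | (proj1_sig b).1 = w0] `*` [set: bool]))); last first.
    by apply/finite_image/finite_setX; [exact: finite_setX|exact: finite_finset].
  move=> S _; have [[[a b] f] ->] := square_orbit S.
  have [g Gg ge] := Gamma_trans ((proj1_sig a).1, (proj1_sig b).1) (u0, w0).
  exists (bt_acte g.1 a, bt_acte g.2 b, f).
    by split=> //; split; [exact: (congr1 fst ge)|exact: (congr1 snd ge)].
  by apply/esym/osP; exists g.
Qed.

(* E is the image of the horizontal (resp. vertical) edge from (u0, w0) to g (u0, w0). *)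
Definition hlift (E : edge Sigma) g := Gamma g /\ bt_act g.2 w0 = w0 /\
  exists2 a, proj1_sig a = (u0, bt_act g.1 u0) & E = oe (inl (a, w0)).

Definition vlift (E : edge Sigma) g := Gamma g /\ bt_act g.1 u0 = u0 /\
  exists2 b, proj1_sig b = (w0, bt_act g.2 w0) & E = oe (inr (u0, b)).

Lemma hlift_exists E : horizontal E -> exists g, hlift E g.
Proof.
have [e ->] := edge_orbit E; rewrite horizontal_orbit; case: e => // -[a v] _.
have [h Gh he] := Gamma_trans ((proj1_sig a).1, v) (u0, w0).
have [g Gg ge] := Gamma_trans (u0, w0) (bt_act h.1 (proj1_sig a).2, w0).
have [ha hv] : bt_act h.1 (proj1_sig a).1 = u0 /\ bt_act h.2 v = w0.
  by have [] := (congr1 fst he, congr1 snd he).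
have [ga gv] : bt_act g.1 u0 = bt_act h.1 (proj1_sig a).2 /\ bt_act g.2 w0 = w0.
  by have [] := (congr1 fst ge, congr1 snd ge).
exists g; split=> //; split=> //; exists (bt_acte h.1 a); first by rewrite /= ha ga.
by apply/oeP; exists h; rewrite //= hv.
Qed.

Lemma vlift_exists E : ~ horizontal E -> exists g, vlift E g.
Proof.
have [e ->] := edge_orbit E; rewrite horizontal_orbit; case: e => [[? ?] /(_ I)//|[u b] _].
have [h Gh he] := Gamma_trans (u, (proj1_sig b).1) (u0, w0).
have [g Gg ge] := Gamma_trans (u0, w0) (u0, bt_act h.2 (proj1_sig b).2).
have [hu hb] : bt_act h.1 u = u0 /\ bt_act h.2 (proj1_sig b).1 = w0.
  by have [] := (congr1 fst he, congr1 snd he).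
have [gu gb] : bt_act g.1 u0 = u0 /\ bt_act g.2 w0 = bt_act h.2 (proj1_sig b).2.
  by have [] := (congr1 fst ge, congr1 snd ge).
exists g; split=> //; split=> //; exists (bt_acte h.2 b); first by rewrite /= hb gb.
by apply/oeP; exists h; rewrite //= hu.
Qed.

Lemma fix_base g : Gamma g -> bt_act g.1 u0 = u0 -> bt_act g.2 w0 = w0 -> g = 1%g.
Proof.
move=> Gg e1 e2; apply: (@freeV _ _ (u0, w0)) => //; first by case: Gamma_sub.
by rewrite act_vert1 /act_vert /= e1 e2.
Qed.

Lemma eq_base g h : Gamma g -> Gamma h -> bt_act g.1 u0 = bt_act h.1 u0 ->
  bt_act g.2 w0 = bt_act h.2 w0 -> g = h.
Proof.
move=> Gg Gh e1 e2; apply: (@freeV _ _ (u0, w0)) => //.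
by rewrite /act_vert /= e1 e2.
Qed.

(** Two lifts of E issued from the base vertex differ by an element of Gamma fixing that vertex,
    hence coincide. *)
Lemma hlift_edge E g a : hlift E g -> (proj1_sig a).1 = u0 -> E = oe (inl (a, w0)) ->
  proj1_sig a = (u0, bt_act g.1 u0).
Proof.
move=> [_ [_ [a' ea' ->]]] ea /oe_inl[h Gh [ha hw]].
have h1 : h = 1%g.
  have e1 : (proj1_sig a').1 = u0 by rewrite ea'.
  by apply: fix_base => //; rewrite -[in LHS]e1 -ea -ha.
by rewrite -ha h1 bt_acte1.
Qed.

Lemma vlift_edge E g b : vlift E g -> (proj1_sig b).1 = w0 -> E = oe (inr (u0, b)) ->
  proj1_sig b = (w0, bt_act g.2 w0).
Proof.
move=> [_ [_ [b' eb' ->]]] eb /oe_inr[h Gh [hu hb]].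
have h1 : h = 1%g.
  have e1 : (proj1_sig b').1 = w0 by rewrite eb'.
  by apply: fix_base => //; rewrite -[in LHS]e1 -eb -hb.
by rewrite -hb h1 bt_acte1.
Qed.

Lemma hlift_inj E F g h : hlift E g -> hlift F h -> bt_act g.1 u0 = bt_act h.1 u0 -> E = F.
Proof.
move=> [_ [_ [a ea ->]]] [_ [_ [b eb ->]]] e; congr (oe (inl (_, _))).
by apply: bt_edge_eq; rewrite ea eb //= e.
Qed.

Lemma vlift_unique E g h : vlift E g -> vlift E h -> g = h.
Proof.
move=> lg lh; have [Gg [gu [b eb Eb]]] := lg; have [Gh [hu _]] := lh.
apply: eq_base => //; first by rewrite gu hu.
by have := vlift_edge lh (congr1 fst eb) Eb; rewrite eb => /(congr1 snd).
Qed.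

(** The reversed edge runs from g w0 to w0, and g^-1 brings its origin back to the base vertex. *)
Lemma vlift_einv E g : vlift E g -> vlift (einv E) g^-1%g.
Proof.
move=> [Gg [gu [b eb ->]]]; split; first exact: GV.
have gu' : bt_act g^-1%g.1 u0 = u0 by rewrite -{1}gu -bt_actM mulVg bt_act1.
split=> //; exists (bt_acte g^-1%g.2 (bt_einv b)).
  by rewrite /= eb /= -bt_actM mulVg bt_act1.
rewrite einv_orbit; apply/oeP; exists g^-1%g; first exact: GV.
by rewrite -[LHS]/(inr (bt_act g^-1%g.1 u0, bt_acte g^-1%g.2 (bt_einv b))) gu'.
Qed.

(* Both sides map (u0, w0) to the corner opposite to (u0, w0) in the lift of S. *)
Lemma square_lift (S : square Sigma) gx gq gx' gq' :
  hlift (side S) gx -> vlift (side (flip S)) gq ->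
  hlift (einv (side (Defs.rot (Defs.rot S)))) gx' -> vlift (side (Defs.rot S)) gq' ->
  (gq * gx' = gx * gq')%g.
Proof.
move=> lx lq lx' lq'; have [Gx [xw _]] := lx; have [Gq [qu _]] := lq.
have [Gx' [xw' [a' ea' Ea']]] := lx'; have [Gq' [qu' [b' eb' Eb']]] := lq'.
have [[[a b] f] eS] := square_orbit S.
have [g Gg ge] := Gamma_trans ((proj1_sig a).1, (proj1_sig b).1) (u0, w0).
have {eS} : S = os (bt_acte g.1 a, bt_acte g.2 b, f).
  by rewrite eS; apply/osP; exists g.
have : (proj1_sig (bt_acte g.1 a)).1 = u0 by exact: (congr1 fst ge).
have : (proj1_sig (bt_acte g.2 b)).1 = w0 by exact: (congr1 snd ge).
move: (bt_acte g.1 a) (bt_acte g.2 b) => {g Gg ge} {}a {}b eb ea eS.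
case: f eS => eS; last first.
  have [_ [_ [c _]]] := lx; rewrite eS side_orbit => /oeP[h _].
  by [].
rewrite eS in lx lq Ea' Eb'; rewrite flip_orbit in lq.
rewrite !rot_orbit !side_orbit ?einv_orbit in lx lq Ea' Eb'.
rewrite /= eb in lx; rewrite /= ea in lq.
have {}ea := hlift_edge lx ea erefl; have {}eb := vlift_edge lq eb erefl.
move: Ea' => /esym/oe_inl[h Gh [ha' hw]]; move: Eb' => /esym/oe_inr[k Gk [ku kb']].
have {}ha' : bt_acte h.1 a' = a by rewrite ha'; exact: bt_einvK.
(* [h] carries the lift at the base vertex of the edge opposite to x to its place in the square. It
   sends the base vertex where [gq] does, so it is [gq]; likewise [k] is [gx]. *)
have hq : h = gq.
  apply: eq_base => //; last by rewrite hw /= eb.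
  have e1 : (proj1_sig a').1 = u0 by rewrite ea'.
  have e2 : (proj1_sig a).1 = u0 by rewrite ea.
  by rewrite qu -[in LHS]e1 -e2 -ha'.
have kx : k = gx.
  apply: eq_base => //; first by rewrite ku /= ea.
  have e1 : (proj1_sig b').1 = w0 by rewrite eb'.
  have e2 : (proj1_sig b).1 = w0 by rewrite eb.
  by rewrite xw -[in LHS]e1 -e2 -kb'.
apply: (@freeV _ _ (u0, w0)); [exact: GM|exact: GM|].
rewrite !act_vertM /act_vert /= xw' qu'.
have := congr1 (fun e => (proj1_sig e).2) ha'; rewrite /= ea' ea hq /= => ->.
have := congr1 (fun e => (proj1_sig e).2) kb'; rewrite /= eb' eb kx /= => ->.
by [].
Qed.

End Quotient.

(** * The automaton of the quotient complex *)

Section SquareAutomaton.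
Context (p q : nat) (Kp : padicField p) (Kq : padicField q).
Local Notation PGLxPGL := (PGL2 Kp * PGL2 Kq)%type.
Context (Gamma : set PGLxPGL).

Hypothesis Gamma_sub : subgroup Gamma.
Hypothesis Gamma_discrete : discrete_subgroup Gamma.
Hypothesis Gamma_tf : torsion_free_subgroup Gamma.
Hypothesis Gamma_trans : vertex_transitive Gamma.
Hypothesis Gamma_faithful : forall g, Gamma g -> g.1 = 1%g -> g = 1%g.

Local Notation adjacent := Defs.adjacent.
Local Notation Sigma := (building_quotient Gamma).
Local Notation u0 := (bt0 Kp).
Local Notation w0 := (bt0 Kq).

Let gx (x : hedge Sigma) : PGLxPGL :=
  projT1 (cid (hlift_exists Gamma_sub Gamma_trans (proj2_sig x))).
Let gq (t : vedge Sigma) : PGLxPGL :=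
  projT1 (cid (vlift_exists Gamma_sub Gamma_trans (proj2_sig t))).

Let gxP x : hlift (proj1_sig x) (gx x).
Proof. exact: (projT2 (cid (hlift_exists _ _ (proj2_sig x)))). Qed.

Let gqP t : vlift (proj1_sig t) (gq t).
Proof. exact: (projT2 (cid (vlift_exists _ _ (proj2_sig t)))). Qed.

Let act (g : PGLxPGL) (u : bt_vertex Kp) := bt_act g.1 u.

Let prod_in (I : Type) (s : seq I) (F : I -> PGLxPGL) :
  (forall i, Gamma (F i)) -> Gamma (\prod_(i <- s) F i)%g.
Proof.
move=> GF; elim: s => [|i s IH]; first by rewrite big_nil; exact: Gamma_sub.1.
by rewrite big_cons; exact: GammaM.
Qed.

Let gq_in t : Gamma (gq t).
Proof. by case: (gqP t). Qed.

Let actM g h u : act (g * h)%g u = act g (act h u).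
Proof. exact: bt_actM. Qed.

Let act1 u : act 1%g u = u.
Proof. exact: bt_act1. Qed.

Let gq_fix t : act (gq t) u0 = u0.
Proof. by case: (gqP t) => _ []. Qed.

Let gx_inj x y : act (gx x) u0 = act (gx y) u0 -> x = y.
Proof.
move=> /(hlift_inj (gxP x) (gxP y)); case: x y => [x hx] [y hy] /= e; subst y.
congr exist; exact: Prop_irrelevance.
Qed.

Lemma AT_square (x : hedge Sigma) (t : vedge Sigma) :
  (gq t * gx (@out (AT Sigma) x t) = gx x * gq (@trans (AT Sigma) x t))%g.
Proof.
have [VH link] := VHT_complex_Sigma Gamma_sub Gamma_discrete Gamma_tf Gamma_trans.
have [_ hinv _] := VH; have rotH := horizontal_side_rot Gamma_sub.
have [S [Sxt Suniq]] := link _ _ (one_vertex_Sigma Gamma_sub Gamma_trans _ _)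
  (proj2_sig x) (proj2_sig t).
have corner S' : at_corner x t S' -> S' = S by move=> /Suniq.
have hS : horizontal (side S) by rewrite Sxt.1; exact: (proj2_sig x).
have vS : ~ horizontal (side (Defs.rot S)) by rewrite rotH; tauto.
have hS' : horizontal (einv (side (Defs.rot (Defs.rot S)))) by rewrite hinv rotH.
have [S1 [/corner -> e1]] : exists s, at_corner x t s /\
    proj1_sig (@trans (AT Sigma) x t) = side (Defs.rot s).
  apply: (@choose_orP _ t [set t' : vedge Sigma | exists s, at_corner x t s /\
    proj1_sig t' = side (Defs.rot s)]).
  by exists (exist (fun e => ~ horizontal e) _ vS), S.
have [S2 [/corner -> e2]] : exists s, at_corner x t s /\
    proj1_sig (@out (AT Sigma) x t) = einv (side (Defs.rot (Defs.rot s))).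
  apply: (@choose_orP _ x [set x' : hedge Sigma | exists s, at_corner x t s /\
    proj1_sig x' = einv (side (Defs.rot (Defs.rot s)))]).
  by exists (exist (fun e => horizontal e) _ hS'), S.
apply: (square_lift Gamma_sub Gamma_discrete Gamma_tf Gamma_trans (S := S)).
- by rewrite Sxt.1.
- by rewrite Sxt.2.
- by rewrite -e2.
- by rewrite -e1.
Qed.

Let gq_inv t : exists t', gq t' = (gq t)^-1%g.
Proof.
have [[_ hinv _] _] := VHT_complex_Sigma Gamma_sub Gamma_discrete Gamma_tf Gamma_trans.
have v : ~ horizontal (einv (proj1_sig t)) by rewrite hinv; exact: (proj2_sig t).
exists (exist (fun e => ~ horizontal e) _ v).
by apply: (vlift_unique Gamma_sub Gamma_discrete Gamma_tf Gamma_trans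
    (E := einv (proj1_sig t)));
  [exact: gqP|exact: vlift_einv].
Qed.

Let gq_adj t : adjacent w0 (bt_act (gq t).2 w0).
Proof.
by have [_ [_ [b eb _]]] := gqP t; have := proj2_sig b; rewrite eb.
Qed.

(** The element of Gamma reached so far pulls the next edge of the path back to u0, where it is the
    lift of a letter. *)
Let hol_reach (V : nat -> bt_vertex Kp) : V 0%N = u0 ->
  (forall n, adjacent (V n) (V n.+1)) ->
  forall n, exists w, V n = act (\prod_(x <- w) gx x)%g u0.
Proof.
move=> V0 adjV; elim=> [|n [w ew]]; first by exists [::]; rewrite big_nil act1.
set g := (\prod_(x <- w) gx x)%g in ew.
have a : adjacent u0 (act g^-1%g (V n.+1)).
  have := bt_act_adjacent g^-1%g.1 (adjV n).
  by rewrite ew -[bt_act _ (act g u0)]actM mulVg act1.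
pose E := orbit_of (@act_edge _ _ Kp Kq) Gamma
  (inl (exist (fun e => adjacent e.1 e.2) (u0, act g^-1%g (V n.+1)) a, w0)).
have hE : @horizontal Sigma E by rewrite horizontal_orbit.
pose x : hedge Sigma := exist _ E hE.
exists (rcons w x); rewrite -cats1 big_cat big_seq1 actM.
have /(congr1 snd) /= e := hlift_edge Gamma_sub Gamma_discrete Gamma_tf Gamma_trans
  (a := exist _ (u0, act g^-1%g (V n.+1)) a) (gxP x) erefl erefl.
by rewrite -[act (gx x) u0]e -actM mulgV act1.
Qed.

Let gq_faithful (s : seq (vedge Sigma)) :
  (forall w, act ((\prod_(t <- s) gq t) * \prod_(x <- w) gx x)%g u0 =
     act (\prod_(x <- w) gx x)%g u0) -> (\prod_(t <- s) gq t)%g = 1%g.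
Proof.
move=> fixw; apply: Gamma_faithful; first exact: prod_in.
apply: bt_faithful => c n c1.
have [w ->] := hol_reach (ray_vertex0 c1) (fun n => ray_adjacent n c1) n.
by have := fixw w; rewrite actM.
Qed.

Let gq_square t : (gq t * gq t)%g <> 1%g.
Proof.
move=> e; apply: (@adjacent_irr _ Kq w0); have := gq_adj t.
by rewrite (Gamma_tf (n := 2) (gq_in t)) // bt_act1.
Qed.

(** The images of w0 under the partial products form a path of [T_v]. A backtrack would make the
    product of two consecutive [gq] fix w0; it also fixes u0, so it would be 1. *)
Let gq_free (s : seq (vedge Sigma)) : s <> [::] -> nonbacktracking (map gq s) ->
  (\prod_(t <- s) gq t)%g <> 1%g.
Proof.
case: s => // t0 s' _; move: {1 3 4}(t0 :: s') (erefl (size (t0 :: s'))) => s /= ss nb e.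
pose V i := bt_act (\prod_(t <- take i s) gq t)%g.2 w0.
have VS i : (i < size s)%N ->
    V i.+1 = bt_act (\prod_(t <- take i s) gq t)%g.2 (bt_act (gq (nth t0 s i)).2 w0).
  by move=> lt; rewrite /V (take_nth t0) // -cats1 big_cat big_seq1 -bt_actM.
(* The path has [size s], that is [(size s').+1], edges. *)
apply: (@bt_acyclic _ _ V (size s')).
- move=> i ile; rewrite VS ?ss //; exact: bt_act_adjacent.
- move=> i ilt; have ilt' : (i.+1 < size s)%N by rewrite ss ltnS.
  rewrite VS // (take_nth t0) ?(ltnW ilt') // -cats1 big_cat big_seq1 /=.
  rewrite bt_actM -bt_actM => /(congr1 (bt_act (\prod_(t <- take i s) gq t)%g.2^-1%g)).
  rewrite -!bt_actM !mulVg -!mulgA mulKg bt_act1 => fixw.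
  have : (gq (nth t0 s i) * gq (nth t0 s i.+1) = 1)%g.
    apply: (fix_base Gamma_sub Gamma_discrete Gamma_tf Gamma_trans) => //.
      exact: GammaM.
    by rewrite -[bt_act _ _]/(act _ _) actM !gq_fix.
  move/(sortedP 1%g): nb => /(_ i); rewrite size_map => /(_ ilt').
  by rewrite !(nth_map t0) ?(ltnW ilt') // => /eqP.
- by rewrite /V -ss take_size e take0 big_nil.
Qed.

Lemma AT_invertible : invertible (AT Sigma).
Proof.
exact: (@automaton_invertible (AT Sigma) _ _ act u0 gx gq actM act1 gq_fix gx_inj
  AT_square gq_inv).
Qed.

Lemma AT_group_free : free_subgroup (automaton_group (AT Sigma)).
Proof.
exact: (@automaton_group_free (AT Sigma) _ _ act u0 gx gq actM act1 gq_fix gx_inj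
  AT_square gq_inv gq_faithful
  gq_square gq_free).
Qed.

End SquareAutomaton.

Theorem proposition3p4 (R : realType) (p q : nat) (p_prime : prime p)
    (q_prime : prime q) (Kp : padicField p) (Kq : padicField q)
    (Gamma : set (PGL2 Kp * PGL2 Kq)) :
  is_lattice R Gamma ->
  is_arithmetic Gamma ->
  irreducible_lattice Gamma ->
  torsion_free_subgroup Gamma ->
  vertex_transitive Gamma ->
  let Sigma := building_quotient Gamma in
  [/\ finite_complex Sigma, is_VHT_complex Sigma & one_vertex Sigma] /\
  invertible (AT Sigma) /\
  free_subgroup (automaton_group (AT Sigma)).
Proof.
move=> [Gs Gd _] ar _ tf tr /=; have faith := arithmetic_faithful Gs tf ar.
split; first split.
- exact: finite_complex_Sigma.
- exact: VHT_complex_Sigma.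
- exists (orbit_of (@act_vert _ _ Kp Kq) Gamma (bt0 Kp, bt0 Kq)) => w.
  exact: one_vertex_Sigma.
split; first exact: AT_invertible.
exact: AT_group_free.
Qed.
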